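(* Let $X$ be a locally complete poset, and let $f\colon(A,\alpha)\to(B,\beta)$ be a morphism in $\mathsf{Pos}//X$. Then: (1) $f$ is a regular epimorphism in $\mathsf{Pos}//X$ if and only if $f$ is a regular epimorphism in $\mathsf{Pos}$ and $$\forall\, b\in B,\quad \beta(b)=\bigvee_{f(a)\le b}\alpha(a).$$ (2) $f$ is a stable regular epimorphism in $\mathsf{Pos}//X$ if and only if $f$ is a stable regular epimorphism in $\mathsf{Pos}$ and $$\forall\, b\in B,\ \forall\, w\le\beta(b),\quad w=\bigvee_{f(a)=b} w\wedge\alpha(a).$$ (3) $f$ is an effective descent morphism in $\mathsf{Pos}//X$ if and only if all of the following hold: - $f$ is an effective descent morphism in $\mathsf{Pos}$; - for all $b_0\le b_1$ in $B$ and all $w\le\beta(b_0)$ in $X$, $$w=\bigvee_{\substack{a_0\le a_1\\ f(a_0)=b_0,\ f(a_1)=b_1}} w\wedge\alpha(a_0);$$ - for every family $(\sigma(a))_{a\in A}$ of elements of $X$ with $\sigma(a)\le\alpha(a)$ for all $a\in A$ satisfying $$\forall\, b\in B,\ \forall\, a,a'\in f^{-1}(b),\quad \sigma(a')\wedge\alpha(a)\cong\alpha(a')\wedge\sigma(a),$$ we have $$\forall\, b\in B,\ \forall\, a'\in f^{-1}(b),\quad \alpha(a')\wedge\bigvee_{a\in f^{-1}(b)}\sigma(a)\cong\sigma(a').$$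
   Context: $\mathsf{Pos}$ is the category of posets (sets with a reflexive, transitive, antisymmetric relation) and monotone maps. For $x,y$ in an ordered set, $x\cong y$ means $x\le y$ and $y\le x$; in a poset this is equality. For $x\in X$, $\downarrow x=\{y\in X: y\le x\}$. A poset $X$ is locally complete if $\downarrow x$ is complete for every $x\in X$. The symbols $\wedge$ and $\bigvee$ denote meets and joins; local completeness guarantees that they exist in the sets $\downarrow x$. The families $\sigma$ are arbitrary functions, not assumed monotone. For a poset $X$, the category $\mathsf{Pos}//X$ has as objects pairs $(A,\alpha)$ with $A$ a poset and $\alpha\colon A\to X$ a monotone map; a morphism $f\colon(A,\alpha)\to(B,\beta)$ is a monotone map $f\colon A\to B$ with $\alpha(a)\le\beta(f(a))$ for all $a\in A$. In a category $\mathsf{A}$ with pullbacks: a regular epimorphism is a coequalizer of some parallel pair; a stable regular epimorphism is a morphism all of whose pullbacks are regular epimorphisms; a morphism $p\colon E\to B$ is an effective descent morphism if the comparison functor from $\mathsf{A}/B$ to the Eilenberg–Moore category of the monad induced by the adjunction $p_!\dashv p^*$ is an equivalence, where $p^*\colon\mathsf{A}/B\to\mathsf{A}/E$ is pullback along $p$ and $p_!$ is its left adjoint.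
   Formalization: Parts (1) and (2) additionally assume that every nonempty join computed in some ↓x is a join in X, since with local completeness alone they fail; joins are read in ↓β(b), and in ↓β(b_0) in the second condition of (3). Part (3) has no added assumption. *)

(* Defs.v *)
From Stdlib Require Import Relation_Definitions ProofIrrelevance
  FunctionalExtensionality ClassicalEpsilon.

Set Implicit Arguments.
Unset Strict Implicit.
Unset Printing Implicit Defensive.

Record Poset : Type := {
  carrier :> Type;
  le : relation carrier;
  le_order : order carrier le
}.
Arguments le {p}.

Declare Scope poset_scope.
Delimit Scope poset_scope with poset.
Open Scope poset_scope.

Notation "x ≤ y" := (le x y) (at level 70, no associativity) : poset_scope.
Notation "x ≅ y" := (le x y /\ le y x) (at level 70, no associativity) : poset_scope.

Lemma le_refl (P : Poset) (x : P) : x ≤ x.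
Proof. apply (ord_refl _ _ (le_order P)). Qed.

Lemma le_trans (P : Poset) (x y z : P) : x ≤ y -> y ≤ z -> x ≤ z.
Proof. apply (ord_trans _ _ (le_order P)). Qed.

Lemma le_antisym (P : Poset) (x y : P) : x ≤ y -> y ≤ x -> x = y.
Proof. apply (ord_antisym _ _ (le_order P)). Qed.

Lemma sig_eq (T : Type) (P : T -> Prop) (u v : {x : T | P x}) :
  proj1_sig u = proj1_sig v -> u = v.
Proof. destruct u, v; simpl; intros E; subst; f_equal; apply proof_irrelevance. Qed.

Definition is_lub (P : Poset) (S : P -> Prop) (s : P) : Prop :=
  (forall x, S x -> x ≤ s) /\ (forall t, (forall x, S x -> x ≤ t) -> s ≤ t).

Definition is_glb (P : Poset) (S : P -> Prop) (s : P) : Prop :=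
  (forall x, S x -> s ≤ x) /\ (forall t, (forall x, S x -> t ≤ x) -> t ≤ s).

Definition complete (P : Poset) : Prop :=
  forall S : P -> Prop, (exists s, is_lub S s) /\ (exists i, is_glb S i).

Lemma sub_order (P : Poset) (D : P -> Prop) :
  order {y : P | D y} (fun u v => proj1_sig u ≤ proj1_sig v).
Proof.
  split.
  - intros u; apply le_refl.
  - intros u v w; apply le_trans.
  - intros u v Huv Hvu; apply sig_eq; apply le_antisym; assumption.
Qed.

Definition down (X : Poset) (x : X) : Poset :=
  {| carrier := {y : X | y ≤ x}; le_order := sub_order (fun y => y ≤ x) |}.

Definition locally_complete (X : Poset) : Prop := forall x : X, complete (down x).

(** Local completeness alone does not imply this: in [X = {0, p, q, x, u}] with
    [0] least, [p, q] incomparable, and [x, u] two incomparable upper bounds of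
    [p, q], every [down] is complete, but the join of [p, q] is [x] in [down x]
    and [u] in [down u].  Empty joins are left out: they are bottom elements,
    which differ from one [down x] to another when, for instance, [X] is
    discrete. *)
Definition local_joins_are_joins (X : Poset) : Prop :=
  forall (x : X) (S : down x -> Prop) (s : down x),
    (exists u, S u) -> is_lub S s ->
    is_lub (fun y : X => exists u, S u /\ y = proj1_sig u) (proj1_sig s).

(** [join_in x P F] is the join of the family [F i], [i] ranging over [P],
    computed in [down x]; it is meant for [F i ≤ x].  [meet y z] is computed
    in [X]: all lower bounds of [y ≤ x] lie in [down x], so for [y, z ≤ x] it is
    the same as the meet in [down x].  Both are unspecified when the join or
    meet does not exist. *)
Definition join_in (X : Poset) (x : X) (I : Type) (P : I -> Prop) (F : I -> X) : X :=
  proj1_sig (epsilon (inhabits (exist (fun y => y ≤ x) x (le_refl x) : down x))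
    (is_lub (fun u : down x => exists i, P i /\ F i = proj1_sig u))).

Definition meet (X : Poset) (y z : X) : X :=
  epsilon (inhabits y) (is_glb (fun t => t = y \/ t = z)).

Notation "y ∧ z" := (meet y z) (at level 40, left associativity) : poset_scope.
Notation "'⋁[' x ']_(' i '|' P ')' F" :=
  (join_in x (fun i => P) (fun i => F))
  (at level 41, F at level 41, x at level 200, i binder, P at level 200,
   format "⋁[ x ]_( i  |  P )  F") : poset_scope.

Lemma meet_glb (X : Poset) (hX : locally_complete X) (x y z : X) :
  y ≤ x -> z ≤ x -> is_glb (fun t => t = y \/ t = z) (y ∧ z).
Proof.
  intros Hy Hz; unfold meet; apply epsilon_spec.
  destruct (hX x (fun u => proj1_sig u = y \/ proj1_sig u = z)) as [_ [i [Hl Hg]]].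
  exists (proj1_sig i); split.
  - intros t [-> | ->].
    + exact (Hl (exist _ y Hy) (or_introl eq_refl)).
    + exact (Hl (exist _ z Hz) (or_intror eq_refl)).
  - intros t Ht.
    assert (Htx : t ≤ x) by (apply le_trans with y; auto).
    apply (Hg (exist _ t Htx)); intros u Hu; apply Ht; exact Hu.
Qed.

Lemma meet_lel (X : Poset) (hX : locally_complete X) (x y z : X) :
  y ≤ x -> z ≤ x -> y ∧ z ≤ y.
Proof. intros Hy Hz; apply (meet_glb hX Hy Hz); auto. Qed.

Lemma meet_ler (X : Poset) (hX : locally_complete X) (x y z : X) :
  y ≤ x -> z ≤ x -> y ∧ z ≤ z.
Proof. intros Hy Hz; apply (meet_glb hX Hy Hz); auto. Qed.

Lemma le_meet (X : Poset) (hX : locally_complete X) (x y z t : X) :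
  y ≤ x -> z ≤ x -> t ≤ y -> t ≤ z -> t ≤ y ∧ z.
Proof. intros Hy Hz H1 H2; apply (meet_glb hX Hy Hz); intros u [-> | ->]; assumption. Qed.

Record Category : Type := {
  Ob :> Type;
  Hom : Ob -> Ob -> Type;
  idm : forall a, Hom a a;
  comp : forall a b c, Hom b c -> Hom a b -> Hom a c;
  comp_idl : forall a b (f : Hom a b), comp (idm b) f = f;
  comp_idr : forall a b (f : Hom a b), comp f (idm a) = f;
  comp_assoc : forall a b c d (h : Hom c d) (g : Hom b c) (f : Hom a b),
    comp h (comp g f) = comp (comp h g) f
}.
Arguments Hom {_} _ _.
Arguments idm {_} a.
Arguments comp {_ _ _ _} _ _.

Declare Scope cat_scope.
Delimit Scope cat_scope with cat.
Open Scope cat_scope.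
Notation "g ∘ f" := (comp g f) (at level 40, left associativity) : cat_scope.

Record Functor (C D : Category) : Type := {
  fob :> C -> D;
  fmap : forall a b : C, Hom a b -> Hom (fob a) (fob b);
  fmap_id : forall a : C, fmap (idm a) = idm (fob a);
  fmap_comp : forall (a b c : C) (g : Hom b c) (f : Hom a b),
    fmap (g ∘ f) = fmap g ∘ fmap f
}.
Arguments fmap {C D} _ {_ _} _.

Definition idF (C : Category) : Functor C C.
Proof. refine {| fob := fun a => a; fmap := fun a b f => f |}; reflexivity. Defined.

Definition compF (C D E : Category) (G : Functor D E) (F : Functor C D) : Functor C E.
Proof.
  refine {| fob := fun a => G (F a); fmap := fun a b f => fmap G (fmap F f) |}.
  - intros a; rewrite fmap_id; apply fmap_id.
  - intros a b c g f; rewrite fmap_comp; apply fmap_comp.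
Defined.

Record NatTrans (C D : Category) (F G : Functor C D) : Type := {
  napp :> forall a : C, Hom (F a) (G a);
  naturality : forall (a b : C) (f : Hom a b), napp b ∘ fmap F f = fmap G f ∘ napp a
}.

Definition is_iso (C : Category) (a b : C) (f : Hom a b) : Prop :=
  exists g : Hom b a, g ∘ f = idm a /\ f ∘ g = idm b.

Definition nat_iso (C D : Category) (F G : Functor C D) : Prop :=
  exists t : NatTrans F G, forall a, is_iso (t a).

Definition is_equivalence (C D : Category) (F : Functor C D) : Prop :=
  exists G : Functor D C, nat_iso (compF G F) (idF C) /\ nat_iso (compF F G) (idF D).

Definition is_coequalizer (C : Category) (K E B : C) (u v : Hom K E) (f : Hom E B) : Prop :=
  f ∘ u = f ∘ v /\
  forall (Z : C) (h : Hom E Z), h ∘ u = h ∘ v -> exists! k : Hom B Z, k ∘ f = h.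

Definition regular_epi (C : Category) (E B : C) (f : Hom E B) : Prop :=
  exists (K : C) (u v : Hom K E), is_coequalizer u v f.
Arguments regular_epi C {E B} f.

Definition is_pullback (C : Category) (E Z B P : C) (f : Hom E B) (g : Hom Z B)
    (p1 : Hom P E) (p2 : Hom P Z) : Prop :=
  f ∘ p1 = g ∘ p2 /\
  forall (Q : C) (q1 : Hom Q E) (q2 : Hom Q Z), f ∘ q1 = g ∘ q2 ->
    exists! k : Hom Q P, p1 ∘ k = q1 /\ p2 ∘ k = q2.

Definition stable_regular_epi (C : Category) (E B : C) (f : Hom E B) : Prop :=
  forall (Z P : C) (g : Hom Z B) (p1 : Hom P E) (p2 : Hom P Z),
    is_pullback f g p1 p2 -> regular_epi C p2.
Arguments stable_regular_epi C {E B} f.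

Record Pullbacks (C : Category) : Type := {
  pb : forall E Z B : C, Hom E B -> Hom Z B -> C;
  pb1 : forall (E Z B : C) (f : Hom E B) (g : Hom Z B), Hom (pb f g) E;
  pb2 : forall (E Z B : C) (f : Hom E B) (g : Hom Z B), Hom (pb f g) Z;
  pb_spec : forall (E Z B : C) (f : Hom E B) (g : Hom Z B),
    is_pullback f g (pb1 f g) (pb2 f g)
}.
Arguments pb {C} _ {E Z B} _ _.
Arguments pb1 {C} _ {E Z B} _ _.
Arguments pb2 {C} _ {E Z B} _ _.

Lemma pb_comm (C : Category) (PB : Pullbacks C) (E Z B : C) (f : Hom E B) (g : Hom Z B) :
  f ∘ pb1 PB f g = g ∘ pb2 PB f g.
Proof. apply pb_spec. Qed.

Lemma pb_lift_ex (C : Category) (PB : Pullbacks C) (E Z B Q : C)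
    (f : Hom E B) (g : Hom Z B) (q1 : Hom Q E) (q2 : Hom Q Z) :
  f ∘ q1 = g ∘ q2 ->
  exists k : Hom Q (pb PB f g), pb1 PB f g ∘ k = q1 /\ pb2 PB f g ∘ k = q2.
Proof.
  intros H; destruct (proj2 (pb_spec PB f g) Q q1 q2 H) as [k [Hk _]]; exists k; exact Hk.
Qed.

Definition pb_lift (C : Category) (PB : Pullbacks C) (E Z B Q : C)
    (f : Hom E B) (g : Hom Z B) (q1 : Hom Q E) (q2 : Hom Q Z) (H : f ∘ q1 = g ∘ q2) :
    Hom Q (pb PB f g) :=
  proj1_sig (constructive_indefinite_description _ (pb_lift_ex PB H)).

Lemma pb_lift1 (C : Category) (PB : Pullbacks C) (E Z B Q : C)
    (f : Hom E B) (g : Hom Z B) (q1 : Hom Q E) (q2 : Hom Q Z) (H : f ∘ q1 = g ∘ q2) :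
  pb1 PB f g ∘ pb_lift PB H = q1.
Proof. unfold pb_lift; destruct constructive_indefinite_description as [k [H1 H2]]; exact H1. Qed.

Lemma pb_lift2 (C : Category) (PB : Pullbacks C) (E Z B Q : C)
    (f : Hom E B) (g : Hom Z B) (q1 : Hom Q E) (q2 : Hom Q Z) (H : f ∘ q1 = g ∘ q2) :
  pb2 PB f g ∘ pb_lift PB H = q2.
Proof. unfold pb_lift; destruct constructive_indefinite_description as [k [H1 H2]]; exact H2. Qed.

Lemma pb_lift1_comp (C : Category) (PB : Pullbacks C) (E Z B Q R : C)
    (f : Hom E B) (g : Hom Z B) (q1 : Hom Q E) (q2 : Hom Q Z) (H : f ∘ q1 = g ∘ q2)
    (r : Hom R Q) :
  pb1 PB f g ∘ (pb_lift PB H ∘ r) = q1 ∘ r.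
Proof. rewrite comp_assoc, pb_lift1; reflexivity. Qed.

Lemma pb_lift2_comp (C : Category) (PB : Pullbacks C) (E Z B Q R : C)
    (f : Hom E B) (g : Hom Z B) (q1 : Hom Q E) (q2 : Hom Q Z) (H : f ∘ q1 = g ∘ q2)
    (r : Hom R Q) :
  pb2 PB f g ∘ (pb_lift PB H ∘ r) = q2 ∘ r.
Proof. rewrite comp_assoc, pb_lift2; reflexivity. Qed.

Lemma pb_ext (C : Category) (PB : Pullbacks C) (E Z B Q : C)
    (f : Hom E B) (g : Hom Z B) (k l : Hom Q (pb PB f g)) :
  pb1 PB f g ∘ k = pb1 PB f g ∘ l -> pb2 PB f g ∘ k = pb2 PB f g ∘ l -> k = l.
Proof.
  intros H1 H2.
  destruct (proj2 (pb_spec PB f g) Q (pb1 PB f g ∘ l) (pb2 PB f g ∘ l)) as [m [_ Hm]].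
  - rewrite !comp_assoc, pb_comm; reflexivity.
  - rewrite <- (Hm k), <- (Hm l); auto.
Qed.

Record SliceOb (C : Category) (B : C) : Type := {
  sl_dom : C;
  sl_map : Hom sl_dom B
}.

Definition SliceHom (C : Category) (B : C) (x y : SliceOb B) : Type :=
  {h : Hom (sl_dom x) (sl_dom y) | sl_map y ∘ h = sl_map x}.

Lemma slice_comp_sq (C : Category) (B : C) (x y z : SliceOb B)
    (g : SliceHom y z) (f : SliceHom x y) :
  sl_map z ∘ (proj1_sig g ∘ proj1_sig f) = sl_map x.
Proof. rewrite comp_assoc, (proj2_sig g); exact (proj2_sig f). Qed.

Definition Slice (C : Category) (B : C) : Category.
Proof.
  unshelve refine {|
    Ob := SliceOb B;
    Hom := @SliceHom C B;
    idm := fun x => exist _ (idm (sl_dom x)) (comp_idr (sl_map x));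
    comp := fun x y z g f => exist _ (proj1_sig g ∘ proj1_sig f) (slice_comp_sq g f)
  |}.
  - intros; apply sig_eq, comp_idl.
  - intros; apply sig_eq, comp_idr.
  - intros; apply sig_eq, comp_assoc.
Defined.

Record Adjunction (C D : Category) (F : Functor C D) (G : Functor D C) : Type := {
  adj_unit : NatTrans (idF C) (compF G F);
  adj_counit : NatTrans (compF F G) (idF D);
  triangle_l : forall c : C, adj_counit (F c) ∘ fmap F (adj_unit c) = idm (F c);
  triangle_r : forall d : D, fmap G (adj_counit d) ∘ adj_unit (G d) = idm (G d)
}.

Record Monad (C : Category) : Type := {
  mfun :> Functor C C;
  eta : NatTrans (idF C) mfun;
  mu : NatTrans (compF mfun mfun) mfun;
  mu_eta_l : forall c : C, mu c ∘ eta (mfun c) = idm (mfun c);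
  mu_eta_r : forall c : C, mu c ∘ fmap mfun (eta c) = idm (mfun c);
  mu_mu : forall c : C, mu c ∘ mu (mfun c) = mu c ∘ fmap mfun (mu c)
}.

Record Algebra (C : Category) (T : Monad C) : Type := {
  alg_ob : C;
  alg_act : Hom (T alg_ob) alg_ob;
  alg_unit : alg_act ∘ eta T alg_ob = idm alg_ob;
  alg_assoc : alg_act ∘ mu T alg_ob = alg_act ∘ fmap T alg_act
}.

Definition AlgebraHom (C : Category) (T : Monad C) (x y : Algebra T) : Type :=
  {h : Hom (alg_ob x) (alg_ob y) | h ∘ alg_act x = alg_act y ∘ fmap T h}.

Lemma alg_id_sq (C : Category) (T : Monad C) (x : Algebra T) :
  idm (alg_ob x) ∘ alg_act x = alg_act x ∘ fmap T (idm (alg_ob x)).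
Proof. rewrite fmap_id, comp_idl, comp_idr; reflexivity. Qed.

Lemma alg_comp_sq (C : Category) (T : Monad C) (x y z : Algebra T)
    (g : AlgebraHom y z) (f : AlgebraHom x y) :
  (proj1_sig g ∘ proj1_sig f) ∘ alg_act x
  = alg_act z ∘ fmap T (proj1_sig g ∘ proj1_sig f).
Proof.
  rewrite <- comp_assoc, (proj2_sig f), comp_assoc, (proj2_sig g), fmap_comp, comp_assoc.
  reflexivity.
Qed.

Definition EilenbergMoore (C : Category) (T : Monad C) : Category.
Proof.
  unshelve refine {|
    Ob := Algebra T;
    Hom := @AlgebraHom C T;
    idm := fun x => exist _ (idm (alg_ob x)) (alg_id_sq x);
    comp := fun x y z g f => exist _ (proj1_sig g ∘ proj1_sig f) (alg_comp_sq g f)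
  |}.
  - intros; apply sig_eq, comp_idl.
  - intros; apply sig_eq, comp_idr.
  - intros; apply sig_eq, comp_assoc.
Defined.

Definition adj_monad (C D : Category) (F : Functor C D) (G : Functor D C)
    (adj : Adjunction F G) : Monad C.
Proof.
  unshelve refine {|
    mfun := compF G F;
    eta := adj_unit adj;
    mu := {| napp := fun c => fmap G (adj_counit adj (F c))
      : Hom (compF (compF G F) (compF G F) c) (compF G F c) |}
  |}.
  - intros a b f; simpl; rewrite <- !fmap_comp; f_equal.
    apply (naturality (adj_counit adj) (fmap F f)).
  - intros c; apply (triangle_r adj).
  - intros c; simpl; rewrite <- fmap_comp, <- fmap_id; f_equal; apply (triangle_l adj).
  - intros c; simpl; rewrite <- !fmap_comp; f_equal.
    symmetry; apply (naturality (adj_counit adj) (adj_counit adj (F c))).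
Defined.

Definition comparison (C D : Category) (F : Functor C D) (G : Functor D C)
    (adj : Adjunction F G) : Functor D (EilenbergMoore (adj_monad adj)).
Proof.
  unshelve refine {|
    fob := fun d => {|
      alg_ob := G d;
      alg_act := fmap G (adj_counit adj d) : Hom (adj_monad adj (G d)) (G d)
    |} : EilenbergMoore (adj_monad adj);
    fmap := fun a b f => exist _ (fmap G f) _
  |}.
  - apply (triangle_r adj).
  - simpl; rewrite <- !fmap_comp; f_equal.
    symmetry; apply (naturality (adj_counit adj) (adj_counit adj d)).
  - simpl; rewrite <- !fmap_comp; f_equal.
    symmetry; apply (naturality (adj_counit adj) f).
  - intros a; apply sig_eq; simpl; apply fmap_id.
  - intros a b c g f; apply sig_eq; simpl; apply fmap_comp.
Defined.

Lemma slice_post_sq (C : Category) (E B : C) (p : Hom E B) (x y : Slice E) (h : Hom x y) :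
  (p ∘ sl_map y) ∘ proj1_sig h = p ∘ sl_map x.
Proof. rewrite <- comp_assoc, (proj2_sig h); reflexivity. Qed.

(** [p_!]: composition with [p]. *)
Definition slice_post (C : Category) (E B : C) (p : Hom E B) : Functor (Slice E) (Slice B).
Proof.
  unshelve refine {|
    fob := fun x : Slice E =>
      {| sl_dom := sl_dom x; sl_map := p ∘ sl_map x |} : Slice B;
    fmap := fun x y h => exist _ (proj1_sig h) (slice_post_sq p h)
  |}.
  - intros; apply sig_eq; reflexivity.
  - intros; apply sig_eq; reflexivity.
Defined.

Lemma slice_pull_sq (C : Category) (PB : Pullbacks C) (E B : C) (p : Hom E B)
    (x y : Slice B) (h : Hom x y) :
  p ∘ pb1 PB p (sl_map x) = sl_map y ∘ (proj1_sig h ∘ pb2 PB p (sl_map x)).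
Proof. rewrite comp_assoc, (proj2_sig h); apply pb_comm. Qed.

(** [p^*]: pullback along [p]. *)
Definition slice_pull (C : Category) (PB : Pullbacks C) (E B : C) (p : Hom E B) :
    Functor (Slice B) (Slice E).
Proof.
  unshelve refine {|
    fob := fun x : Slice B =>
      {| sl_dom := pb PB p (sl_map x); sl_map := pb1 PB p (sl_map x) |} : Slice E;
    fmap := fun x y h => exist _ (pb_lift PB (slice_pull_sq PB p h)) (pb_lift1 PB (slice_pull_sq PB p h))
  |}.
  - intros x; apply sig_eq; simpl; apply pb_ext.
    + rewrite pb_lift1, comp_idr; reflexivity.
    + rewrite pb_lift2; simpl; rewrite comp_idl, comp_idr; reflexivity.
  - intros x y z g f; apply sig_eq; simpl; apply pb_ext.
    + rewrite pb_lift1_comp, !pb_lift1; reflexivity.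
    + rewrite pb_lift2_comp, <- comp_assoc, !pb_lift2; apply eq_sym, comp_assoc.
Defined.

Lemma slice_unit_sq (C : Category) (E B : C) (p : Hom E B) (w : Slice E) :
  p ∘ sl_map w = sl_map (slice_post p w) ∘ idm (sl_dom w).
Proof. simpl; rewrite comp_idr; reflexivity. Qed.

Definition slice_unit (C : Category) (PB : Pullbacks C) (E B : C) (p : Hom E B) :
    NatTrans (idF (Slice E)) (compF (slice_pull PB p) (slice_post p)).
Proof.
  unshelve refine (Build_NatTrans (F := idF (Slice E))
    (G := compF (slice_pull PB p) (slice_post p))
    (napp := fun w => exist _ (pb_lift PB (slice_unit_sq p w)) (pb_lift1 PB (slice_unit_sq p w))) _).
  - intros x y h; apply sig_eq; simpl; apply pb_ext.
    + rewrite !pb_lift1_comp, pb_lift1; apply (proj2_sig h).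
    + rewrite !pb_lift2_comp, <- comp_assoc, pb_lift2; simpl.
      rewrite comp_idl, comp_idr; reflexivity.
Defined.

Definition slice_counit (C : Category) (PB : Pullbacks C) (E B : C) (p : Hom E B) :
    NatTrans (compF (slice_post p) (slice_pull PB p)) (idF (Slice B)).
Proof.
  unshelve refine (Build_NatTrans (F := compF (slice_post p) (slice_pull PB p))
    (G := idF (Slice B)) (napp := fun x => exist _ (pb2 PB p (sl_map x)) (eq_sym (pb_comm PB p (sl_map x)))) _).
  - intros x y h; apply sig_eq; simpl; apply pb_lift2.
Defined.

Definition slice_adj (C : Category) (PB : Pullbacks C) (E B : C) (p : Hom E B) :
    Adjunction (slice_post p) (slice_pull PB p).
Proof.
  refine {| adj_unit := slice_unit PB p; adj_counit := slice_counit PB p |}.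
  - intros w; apply sig_eq; simpl; apply pb_lift2.
  - intros x; apply sig_eq; simpl; apply pb_ext.
    + rewrite pb_lift1_comp, pb_lift1, comp_idr; reflexivity.
    + rewrite pb_lift2_comp, <- comp_assoc, pb_lift2, !comp_idr; reflexivity.
Defined.

(** The functor [comparison] goes from [C/B] to the algebras of the monad on
    [C/E] induced by [p_! ⊣ p^*].  The condition does not depend on the choice
    [PB] of pullbacks. *)
Definition effective_descent (C : Category) (PB : Pullbacks C) (E B : C) (p : Hom E B) : Prop :=
  is_equivalence (comparison (slice_adj PB p)).

Record Mono (A B : Poset) : Type := {
  mfn :> A -> B;
  monotone : forall x y : A, x ≤ y -> mfn x ≤ mfn y
}.

Lemma mono_eq (A B : Poset) (f g : Mono A B) : (forall x, f x = g x) -> f = g.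
Proof.
  destruct f as [f Hf], g as [g Hg]; simpl; intros E.
  assert (f = g) by (apply functional_extensionality; exact E); subst.
  f_equal; apply proof_irrelevance.
Qed.

Definition Pos : Category.
Proof.
  unshelve refine {|
    Ob := Poset;
    Hom := Mono;
    idm := fun A => {| mfn := fun x : A => x |};
    comp := fun A B C g f => {| mfn := fun x => g (f x) |}
  |}.
  - auto.
  - simpl; intros x y H; apply monotone, monotone, H.
  - intros; apply mono_eq; reflexivity.
  - intros; apply mono_eq; reflexivity.
  - intros; apply mono_eq; reflexivity.
Defined.

Lemma prod_order (A B : Poset) :
  order (A * B) (fun p q => fst p ≤ fst q /\ snd p ≤ snd q).
Proof.
  split.
  - intros p; split; apply le_refl.
  - intros p q r [H1 H2] [H3 H4]; split; eapply le_trans; eauto.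
  - intros [a b] [a' b']; simpl; intros [H1 H2] [H3 H4]; f_equal; apply le_antisym; auto.
Qed.

Definition prodP (A B : Poset) : Poset := {| le_order := prod_order A B |}.

Definition pos_pb (A Z B : Poset) (f : Mono A B) (g : Mono Z B) : Poset :=
  {| carrier := {p : A * Z | f (fst p) = g (snd p)};
     le_order := @sub_order (prodP A Z) (fun p => f (fst p) = g (snd p)) |}.

Definition pos_pb1 (A Z B : Poset) (f : Mono A B) (g : Mono Z B) : Mono (pos_pb f g) A :=
  {| mfn := fun q : pos_pb f g => fst (proj1_sig q);
     monotone := fun q r H => proj1 H |}.

Definition pos_pb2 (A Z B : Poset) (f : Mono A B) (g : Mono Z B) : Mono (pos_pb f g) Z :=
  {| mfn := fun q : pos_pb f g => snd (proj1_sig q);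
     monotone := fun q r H => proj2 H |}.

Definition pos_pb_lift (A Z B Q : Poset) (f : Mono A B) (g : Mono Z B)
    (q1 : Mono Q A) (q2 : Mono Q Z) (H : forall x, f (q1 x) = g (q2 x)) :
    Mono Q (pos_pb f g) :=
  {| mfn := fun x => exist _ (q1 x, q2 x) (H x) : pos_pb f g;
     monotone := fun x y L => conj (monotone q1 L) (monotone q2 L) |}.

Lemma pos_pb_spec (A Z B : Pos) (f : Hom A B) (g : Hom Z B) :
  @is_pullback Pos A Z B (pos_pb f g) f g (pos_pb1 f g) (pos_pb2 f g).
Proof.
  split.
  - apply mono_eq; intros [p Hp]; exact Hp.
  - intros Q q1 q2 H.
    assert (H' : forall x, f (q1 x) = g (q2 x))
      by (intros x; exact (f_equal (fun m : Mono Q B => m x) H)).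
    exists (pos_pb_lift H'); split.
    + split; apply mono_eq; reflexivity.
    + intros k [K1 K2]; subst; apply mono_eq; intros x; apply sig_eq; simpl.
      symmetry; apply surjective_pairing.
Qed.

Definition Pos_pullbacks : Pullbacks Pos := {| pb_spec := pos_pb_spec |}.

Record LaxOb (X : Poset) : Type := {
  lax_dom : Poset;
  lax_map : Mono lax_dom X
}.

Record LaxHom (X : Poset) (A B : LaxOb X) : Type := {
  lax_fn : Mono (lax_dom A) (lax_dom B);
  lax_le : forall a, lax_map A a ≤ lax_map B (lax_fn a)
}.
Arguments Build_LaxHom {X} A B lax_fn lax_le.

Lemma lax_eq (X : Poset) (A B : LaxOb X) (f g : LaxHom A B) :
  (forall a, lax_fn f a = lax_fn g a) -> f = g.
Proof.
  intros E; apply mono_eq in E; destruct f as [f Hf], g as [g Hg]; simpl in E; subst.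
  f_equal; apply proof_irrelevance.
Qed.

Definition PosLax (X : Poset) : Category.
Proof.
  unshelve refine {|
    Ob := LaxOb X;
    Hom := @LaxHom X;
    idm := fun A => Build_LaxHom A A (idm (lax_dom A : Pos)) _;
    comp := fun A B C g f => Build_LaxHom A C
      ((lax_fn g : Hom (lax_dom B : Pos) (lax_dom C)) ∘ lax_fn f) _
  |}.
  - intros a; apply le_refl.
  - intros a; simpl; apply le_trans with (lax_map B (lax_fn f a)); apply lax_le.
  - intros; apply lax_eq; reflexivity.
  - intros; apply lax_eq; reflexivity.
  - intros; apply lax_eq; reflexivity.
Defined.

Definition lax_pb (X : Poset) (hX : locally_complete X) (A Z B : LaxOb X)
    (f : LaxHom A B) (g : LaxHom Z B) : LaxOb X.
Proof.
  unshelve refine {|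
    lax_dom := pos_pb (lax_fn f) (lax_fn g);
    lax_map := {| mfn := fun q : pos_pb (lax_fn f) (lax_fn g) =>
      lax_map A (fst (proj1_sig q)) ∧ lax_map Z (snd (proj1_sig q)) |}
  |}.
  intros [[a z] E] [[a' z'] E'] [H1 H2]; simpl in *.
  assert (Ha := lax_le f a); assert (Hz := lax_le g z); rewrite <- E in Hz.
  assert (Ha' := lax_le f a'); assert (Hz' := lax_le g z'); rewrite <- E' in Hz'.
  apply (le_meet hX Ha' Hz').
  - apply le_trans with (lax_map A a); [apply (meet_lel hX Ha Hz) | apply monotone, H1].
  - apply le_trans with (lax_map Z z); [apply (meet_ler hX Ha Hz) | apply monotone, H2].
Defined.

Definition lax_pb1 (X : Poset) (hX : locally_complete X) (A Z B : LaxOb X)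
    (f : LaxHom A B) (g : LaxHom Z B) : LaxHom (lax_pb hX f g) A.
Proof.
  refine (Build_LaxHom (lax_pb hX f g) A (pos_pb1 (lax_fn f) (lax_fn g)) _).
  intros [[a z] E]; simpl in *.
  apply (meet_lel hX (lax_le f a)); rewrite E; apply lax_le.
Defined.

Definition lax_pb2 (X : Poset) (hX : locally_complete X) (A Z B : LaxOb X)
    (f : LaxHom A B) (g : LaxHom Z B) : LaxHom (lax_pb hX f g) Z.
Proof.
  refine (Build_LaxHom (lax_pb hX f g) Z (pos_pb2 (lax_fn f) (lax_fn g)) _).
  intros [[a z] E]; simpl in *.
  apply (meet_ler hX (lax_le f a)); rewrite E; apply lax_le.
Defined.

Lemma lax_pb_spec (X : Poset) (hX : locally_complete X) (A Z B : PosLax X)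
    (f : Hom A B) (g : Hom Z B) :
  @is_pullback (PosLax X) A Z B (lax_pb hX f g) f g (lax_pb1 hX f g) (lax_pb2 hX f g).
Proof.
  split.
  - apply lax_eq; intros [p Hp]; exact Hp.
  - intros Q q1 q2 H.
    assert (H' : forall x, lax_fn f (lax_fn q1 x) = lax_fn g (lax_fn q2 x))
      by (intros x; exact (f_equal (fun m : LaxHom Q B => lax_fn m x) H)).
    assert (L : forall x, lax_map Q x ≤ lax_map (lax_pb hX f g) (pos_pb_lift H' x)).
    { intros x; simpl.
      apply (le_meet hX (lax_le f (lax_fn q1 x))); try apply lax_le.
      rewrite H'; apply lax_le. }
    exists (Build_LaxHom Q (lax_pb hX f g) (pos_pb_lift H') L); split.
    + split; apply lax_eq; reflexivity.
    + intros k [K1 K2]; subst; apply lax_eq; intros x; apply sig_eq; simpl.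
      symmetry; apply surjective_pairing.
Qed.

Definition PosLax_pullbacks (X : Poset) (hX : locally_complete X) : Pullbacks (PosLax X) :=
  {| pb_spec := lax_pb_spec hX |}.

(* Main.v *)
From Stdlib Require Import ProofIrrelevance Classical ClassicalEpsilon
  PropExtensionality Relation_Definitions.
Require Import Defs.

Set Implicit Arguments.
Unset Strict Implicit.
Unset Printing Implicit Defensive.

(** An algebra of the monad of [p_! ⊣ p^*] is an object [γ : Z -> E] with an
    action [(a, c) ↦ a · c] of [E ×_B Z] on [Z], and [p] is of effective descent
    when every such [Z] is [E ×_B D] for an essentially unique [D] over [B].
    Limits in [Pos//X] are computed on underlying posets, so a descent datum in
    [Pos//X] is one in [Pos] together with a decoration [θ : Z -> X] satisfying
    [θ c ≤ α (γ c)] and [α a ∧ θ c ≤ θ (a · c)].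

    If [D] descends [Z], the only candidate decoration of [D] is the fibrewise
    join of [θ]. Along each fibre [θ] is a compatible family [σ], so the third
    condition of (3) says that the candidate restricts to [θ] on [Z], while the
    second makes it monotone. Conversely, a compatible family is a datum on [A]
    ordered fibrewise, and any object over [B] is decorated by [β]. *)

(** * Equivalences as fully faithful and essentially surjective functors *)

Definition fully_faithful (C D : Category) (F : Functor C D) : Prop :=
  forall (a b : C) (h : Hom (F a) (F b)), exists! k : Hom a b, fmap F k = h.

Definition essentially_surjective (C D : Category) (F : Functor C D) : Prop :=
  forall d : D, exists (c : C) (i : Hom (F c) d), is_iso i.

(** Naturality recovers [k] as [t b ∘ G (F k) ∘ s], with [s] inverse to [t a]. Only one isomorphism
    of an equivalence is involved, so this applies to either functor. *)
Lemma faithful_of_retraction (C D : Category) (F : Functor C D) (G : Functor D C) :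
  nat_iso (compF G F) (idF C) ->
  forall (a b : C) (k l : Hom a b), fmap F k = fmap F l -> k = l.
Proof.
  intros [t Ht] a b k l E.
  destruct (Ht a) as [s [_ Hs]].
  assert (Nk := naturality t k); assert (Nl := naturality t l); simpl in *.
  rewrite E in Nk.
  rewrite <- (comp_idr k), <- (comp_idr l), <- Hs, !comp_assoc.
  f_equal; rewrite <- Nk; exact Nl.
Qed.

Lemma equivalence_fully_faithful (C D : Category) (F : Functor C D) :
  is_equivalence F -> fully_faithful F.
Proof.
  intros [G [HGF HFG]] a b h.
  destruct HGF as [t Ht].
  destruct (Ht a) as [s [Hs1 Hs2]], (Ht b) as [r [Hr1 Hr2]]; simpl in *.
  (* Naturality of [t] leaves this as the only candidate. To see that [F] sends it to [h], apply
     [G], which is faithful by the other isomorphism. *)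
  exists (t b ∘ fmap G h ∘ s); split.
  - apply (faithful_of_retraction HFG).
    assert (N := naturality t (t b ∘ fmap G h ∘ s)); simpl in *.
    assert (E : forall x : Hom (G (F a)) (G (F b)), r ∘ (t b ∘ x) = x)
      by (intros x; etransitivity; [apply comp_assoc |];
          etransitivity; [exact (f_equal (fun z => z ∘ x) Hr1) | apply comp_idl]).
    etransitivity; [symmetry; apply E |].
    etransitivity; [apply f_equal | apply E].
    etransitivity; [apply N |].
    etransitivity; [symmetry; apply comp_assoc |].
    etransitivity; [exact (f_equal (fun z => _ ∘ z) Hs1) | apply comp_idr].
  - intros k <-.
    assert (N := naturality t k); simpl in *.
    rewrite N; etransitivity; [symmetry; apply comp_assoc |].
    etransitivity; [exact (f_equal (fun z => _ ∘ z) Hs2) | apply comp_idr].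
Qed.

Lemma equivalence_essentially_surjective (C D : Category) (F : Functor C D) :
  is_equivalence F -> essentially_surjective F.
Proof. intros [G [_ [t Ht]]] d; exists (G d), (t d); apply Ht. Qed.

(** Choice picks an isomorphism [i d : F (G0 d) -> d] for each [d], with inverse [j d]; [G h] is the
    preimage of [h] conjugated by them. Equations in [C] are checked after [F], which is injective
    on maps. *)
Lemma equivalence_intro (C D : Category) (F : Functor C D) :
  fully_faithful F -> essentially_surjective F -> is_equivalence F.
Proof.
  intros HF HE.
  destruct (constructive_indefinite_description
    (fun pre : forall (a b : C), Hom (F a) (F b) -> Hom a b =>
      forall a b h, fmap F (pre a b h) = h)) as [pre Hpre].
  { exists (fun a b h => proj1_sig (constructive_indefinite_description _ (HF a b h))).
    intros a b h; exact (proj1 (proj2_sig (constructive_indefinite_description _ (HF a b h)))). }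
  assert (inj : forall a b (k l : Hom a b), fmap F k = fmap F l -> k = l).
  { intros a b k l E; destruct (HF a b (fmap F l)) as [m [_ Hm]].
    rewrite <- (Hm k E); apply Hm; reflexivity. }
  pose (G0 := fun d => proj1_sig (constructive_indefinite_description _ (HE d))).
  assert (HG : forall d, exists i : Hom (F (G0 d)) d, is_iso i)
    by (intros d; exact (proj2_sig (constructive_indefinite_description _ (HE d)))).
  clearbody G0.
  pose (i := fun d => proj1_sig (constructive_indefinite_description _ (HG d))).
  assert (Hi : forall d, is_iso (i d))
    by (intros d; exact (proj2_sig (constructive_indefinite_description _ (HG d)))).
  clearbody i.
  pose (j := fun d => proj1_sig (constructive_indefinite_description _ (Hi d))).
  assert (Hj : forall d, j d ∘ i d = idm _ /\ i d ∘ j d = idm d)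
    by (intros d; exact (proj2_sig (constructive_indefinite_description _ (Hi d)))).
  clearbody j.
  assert (Hij : forall (d e : D) (x : Hom e d), i d ∘ (j d ∘ x) = x)
    by (intros d e x; rewrite comp_assoc, (proj2 (Hj d)); apply comp_idl).
  unshelve refine (let G : Functor D C :=
    {| fob := G0; fmap := fun a b h => pre _ _ (j b ∘ (h ∘ i a)) |} in _).
  { intros d; apply inj; rewrite Hpre, fmap_id, comp_idl; apply Hj. }
  { intros a b c g h; apply inj; rewrite fmap_comp, !Hpre.
    rewrite <- !comp_assoc, Hij; reflexivity. }
  exists G; split.
  - unshelve eexists.
    { unshelve refine (Build_NatTrans (F := compF G F) (G := idF C)
        (napp := fun a => pre _ _ (i (F a))) _).
      intros a b h; apply inj; simpl; rewrite !fmap_comp, !Hpre; apply Hij. }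
    intros a; exists (pre _ _ (j (F a))); simpl; split; apply inj;
      rewrite fmap_comp, !Hpre, fmap_id; apply Hj.
  - unshelve eexists.
    { unshelve refine (Build_NatTrans (F := compF F G) (G := idF D) (napp := i) _).
      intros a b h; simpl; rewrite Hpre; apply Hij. }
    intros d; exists (j d); apply Hj.
Qed.

(** * Effective descent in terms of generalized elements *)

Section Descent.
Context (C : Category) (PB : Pullbacks C) (E B : C) (p : Hom E B).

(** Laws of a descent datum [(a, c) ↦ a · c] on [γ : Z -> E], on generalized
    elements: [γ (a · c) = a], [γ c · c = c] and [a · (a' · c) = a · c]. *)
Definition descent_datum (Z : C) (γ : Hom Z E) (h : Hom (pb PB p (p ∘ γ)) Z) : Prop :=
  γ ∘ h = pb1 PB p (p ∘ γ) /\
  (forall (Q : C) (u : Hom Q (pb PB p (p ∘ γ))) (c : Hom Q Z),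
     pb1 PB _ _ ∘ u = γ ∘ c -> pb2 PB _ _ ∘ u = c -> h ∘ u = c) /\
  (forall (Q : C) (u v w : Hom Q (pb PB p (p ∘ γ))),
     pb1 PB _ _ ∘ u = pb1 PB _ _ ∘ v -> pb2 PB _ _ ∘ u = pb2 PB _ _ ∘ w ->
     pb2 PB _ _ ∘ v = h ∘ w -> h ∘ u = h ∘ v).

(** Full faithfulness of the comparison functor without the monad: an algebra map from [E ×_B D] to
    [E ×_B D'] is determined by its second component [h], and equivariance means that [h] ignores
    the coordinate in [E]. *)
Definition maps_descend : Prop :=
  forall (D D' : C) (d : Hom D B) (d' : Hom D' B) (h : Hom (pb PB p d) D'),
    d' ∘ h = d ∘ pb2 PB p d ->
    (forall (Q : C) (u v : Hom Q (pb PB p d)),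
       pb2 PB p d ∘ u = pb2 PB p d ∘ v -> h ∘ u = h ∘ v) ->
    exists! k : Hom D D', d' ∘ k = d /\ k ∘ pb2 PB p d = h.

(** [q] is the descended object's quotient map, [r] the inverse of
    [(γ, q) : Z -> E ×_B D]. *)
Definition data_descend : Prop :=
  forall (Z : C) (γ : Hom Z E) (h : Hom (pb PB p (p ∘ γ)) Z), descent_datum h ->
    exists (D : C) (d : Hom D B) (q : Hom Z D) (r : Hom (pb PB p d) Z),
      d ∘ q = p ∘ γ /\ q ∘ h = q ∘ pb2 PB p (p ∘ γ) /\
      γ ∘ r = pb1 PB p d /\ q ∘ r = pb2 PB p d /\
      (forall (Q : C) (u : Hom Q (pb PB p d)) (c : Hom Q Z),
         pb1 PB p d ∘ u = γ ∘ c -> pb2 PB p d ∘ u = q ∘ c -> r ∘ u = c).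

Local Notation T := (adj_monad (slice_adj PB p)).
Local Notation K := (comparison (slice_adj PB p)).

(** On elements, [(a, (a', x)) ↦ (a, x)]. For [d = p ∘ γ] this is also the multiplication of the
    monad at [γ]. *)
Definition counit_act (D : C) (d : Hom D B) :
    Hom (pb PB p (p ∘ pb1 PB p d)) (pb PB p d) :=
  proj1_sig (alg_act (K (Build_SliceOb d))).

Lemma counit_act1 (D : C) (d : Hom D B) :
  pb1 PB p d ∘ counit_act d = pb1 PB p (p ∘ pb1 PB p d).
Proof. apply pb_lift1. Qed.

Lemma counit_act2 (D : C) (d : Hom D B) :
  pb2 PB p d ∘ counit_act d = pb2 PB p d ∘ pb2 PB p (p ∘ pb1 PB p d).
Proof. apply pb_lift2. Qed.

(** On elements, [(a, c) ↦ (a, h c)]. *)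
Definition monad_map (Z Z' : C) (γ : Hom Z E) (γ' : Hom Z' E) (h : Hom Z Z')
    (e : γ' ∘ h = γ) : Hom (pb PB p (p ∘ γ)) (pb PB p (p ∘ γ')) :=
  proj1_sig (@fmap _ _ T (Build_SliceOb γ) (Build_SliceOb γ') (exist _ h e)).

Lemma monad_map1 (Z Z' : C) (γ : Hom Z E) (γ' : Hom Z' E) (h : Hom Z Z')
    (e : γ' ∘ h = γ) :
  pb1 PB p (p ∘ γ') ∘ monad_map e = pb1 PB p (p ∘ γ).
Proof. apply pb_lift1. Qed.

Lemma monad_map2 (Z Z' : C) (γ : Hom Z E) (γ' : Hom Z' E) (h : Hom Z Z')
    (e : γ' ∘ h = γ) :
  pb2 PB p (p ∘ γ') ∘ monad_map e = h ∘ pb2 PB p (p ∘ γ).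
Proof. apply pb_lift2. Qed.

(** On elements, [c ↦ (γ c, c)]. *)
Definition monad_unit (Z : C) (γ : Hom Z E) : Hom Z (pb PB p (p ∘ γ)) :=
  proj1_sig (eta T (Build_SliceOb γ)).

Lemma monad_unit1 (Z : C) (γ : Hom Z E) : pb1 PB p (p ∘ γ) ∘ monad_unit γ = γ.
Proof. apply pb_lift1. Qed.

Lemma monad_unit2 (Z : C) (γ : Hom Z E) : pb2 PB p (p ∘ γ) ∘ monad_unit γ = idm Z.
Proof. apply pb_lift2. Qed.

(** Pairing [h] with the projection to [E] gives a map [H] of algebras, as [h] does not see the
    coordinate that the action changes. The preimage of [H] is the descended map. *)
Lemma comparison_fully_faithful : fully_faithful K -> maps_descend.
Proof.
  intros HF D D' d d' h Hd Hh.
  assert (L : p ∘ pb1 PB p d = d' ∘ h) by (rewrite Hd; apply pb_comm).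
  pose (H := exist _ (pb_lift PB L) (pb_lift1 PB L) :
    Hom (slice_pull PB p (Build_SliceOb d)) (slice_pull PB p (Build_SliceOb d'))).
  assert (HH : H ∘ alg_act (K (Build_SliceOb d))
             = alg_act (K (Build_SliceOb d')) ∘ fmap T H).
  { apply sig_eq.
    change (pb_lift PB L ∘ counit_act d = counit_act d' ∘ monad_map (pb_lift1 PB L)).
    apply pb_ext.
    - rewrite pb_lift1_comp, comp_assoc, !counit_act1, monad_map1; reflexivity.
    - rewrite pb_lift2_comp, comp_assoc, counit_act2, <- comp_assoc, monad_map2.
      rewrite comp_assoc, pb_lift2; apply Hh, counit_act2. }
  destruct (HF _ _ (exist _ H HH)) as [[k Hk] [Ek Uk]].
  exists k; split.
  - split; [exact Hk |].
    apply (f_equal (fun z => proj1_sig (proj1_sig z))) in Ek.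
    transitivity (pb2 PB p d' ∘ pb_lift PB L); [| apply pb_lift2].
    etransitivity; [symmetry; apply (pb_lift2 PB (slice_pull_sq PB p
      (exist _ k Hk : @Hom (Slice B) (Build_SliceOb d) (Build_SliceOb d')))) |].
    apply f_equal; exact Ek.
  - intros k' [Hk' Ek'].
    assert (E' : exist _ k Hk = exist _ k' Hk'
      :> @Hom (Slice B) (Build_SliceOb d) (Build_SliceOb d')).
    { apply Uk; apply sig_eq; apply sig_eq; apply pb_ext.
      - etransitivity; [apply pb_lift1 | symmetry; apply pb_lift1].
      - etransitivity; [apply pb_lift2 | symmetry].
        etransitivity; [apply pb_lift2 | symmetry; exact Ek']. }
    exact (f_equal (fun z => proj1_sig z) E').
Qed.

Lemma maps_descend_fully_faithful : maps_descend -> fully_faithful K.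
Proof.
  intros HM [D d] [D' d'] [[H H1] HH].
  change (Hom (pb PB p d) (pb PB p d')) in H.
  change (pb1 PB p d' ∘ H = pb1 PB p d) in H1.
  assert (HA := f_equal (fun z => proj1_sig z) HH).
  change (H ∘ counit_act d = counit_act d' ∘ monad_map H1) in HA.
  destruct (HM D D' d d' (pb2 PB p d' ∘ H)) as [k [[Hk Ek] Uk]].
  { rewrite comp_assoc, <- pb_comm, <- comp_assoc, H1; apply pb_comm. }
  (* If [u] and [v] have the same coordinate in [D], then [u] is the result of [pb1 ∘ u] acting on
     [v]. By equivariance, [H] gives both the same coordinate in [D']. *)
  { intros Q u v Huv.
    assert (L : p ∘ (pb1 PB p d ∘ u) = (p ∘ pb1 PB p d) ∘ v)
      by (rewrite comp_assoc, !pb_comm, <- !comp_assoc, Huv; reflexivity).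
    assert (Eu : counit_act d ∘ pb_lift PB L = u).
    { apply pb_ext; rewrite comp_assoc.
      - rewrite counit_act1; apply pb_lift1.
      - rewrite counit_act2, <- comp_assoc, pb_lift2; symmetry; exact Huv. }
    rewrite <- Eu, <- !comp_assoc, (comp_assoc H), HA, !comp_assoc, counit_act2.
    rewrite <- (comp_assoc (pb2 PB p d')), monad_map2, <- !comp_assoc, pb_lift2.
    reflexivity. }
  exists (exist _ k Hk); split.
  - apply sig_eq; apply sig_eq; apply pb_ext.
    + etransitivity; [apply pb_lift1 | symmetry; exact H1].
    + etransitivity; [apply pb_lift2 | exact Ek].
  - intros [k' Hk'] Ek'; apply sig_eq; apply Uk; split; [exact Hk' |].
    apply (f_equal (fun z => proj1_sig (proj1_sig z))) in Ek'.
    etransitivity; [symmetry; apply (pb_lift2 PB (slice_pull_sq PB p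
      (exist _ k' Hk' : @Hom (Slice B) (Build_SliceOb d) (Build_SliceOb d')))) |].
    apply f_equal; exact Ek'.
Qed.

(** The laws of a datum at universal generalized elements are those of an algebra. The isomorphism
    from the algebra of some [d] is [r]; its inverse [j] followed by the projection to [D] is
    [q]. *)
Lemma comparison_essentially_surjective : essentially_surjective K -> data_descend.
Proof.
  intros HE Z γ h [Hγ [Hu Ha]].
  pose (x := Build_SliceOb γ : Slice E).
  pose (a := exist _ h Hγ : Hom (T x) x).
  assert (A1 : a ∘ eta T x = idm x).
  { apply sig_eq; change (h ∘ monad_unit γ = idm Z).
    apply Hu; [rewrite comp_idr; apply monad_unit1 | apply monad_unit2]. }
  assert (A2 : a ∘ mu T x = a ∘ fmap T a).
  { apply sig_eq.
    change (h ∘ counit_act (p ∘ γ) = h ∘ monad_map Hγ).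
    (* At the universal element [(a, (a', c))], [u] is [(a, c)], [v] is [(a, a' · c)] and [w] is
       [(a', c)]. *)
    apply (Ha _ _ _ (pb2 PB p (p ∘ pb1 PB p (p ∘ γ)))).
    - rewrite counit_act1, monad_map1; reflexivity.
    - apply counit_act2.
    - apply monad_map2. }
  destruct (HE {| alg_ob := x; alg_act := a; alg_unit := A1; alg_assoc := A2 |})
    as [[D d] [[[r Hr] Ar] [[[j Hj] Aj] [Jr Rj]]]].
  apply (f_equal (fun z => proj1_sig (proj1_sig z))) in Jr, Rj; simpl in Jr, Rj.
  apply (f_equal (fun z => proj1_sig z)) in Aj.
  change (Hom Z (pb PB p d)) in j; change (Hom (pb PB p d) Z) in r.
  change (pb1 PB p d ∘ j = γ) in Hj; change (γ ∘ r = pb1 PB p d) in Hr.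
  change (j ∘ r = idm _) in Jr; change (r ∘ j = idm _) in Rj.
  change (j ∘ h = counit_act d ∘ monad_map Hj) in Aj.
  exists D, d, (pb2 PB p d ∘ j), r; repeat split.
  - rewrite comp_assoc, <- pb_comm, <- comp_assoc, Hj; reflexivity.
  - rewrite <- comp_assoc, Aj, comp_assoc, counit_act2, <- comp_assoc, monad_map2.
    apply comp_assoc.
  - exact Hr.
  - rewrite <- comp_assoc, Jr; apply comp_idr.
  - intros Q u c H1 H2.
    assert (Eu : u = j ∘ c).
    { apply pb_ext; rewrite comp_assoc; [rewrite Hj; exact H1 | exact H2]. }
    rewrite Eu, comp_assoc, Rj; apply comp_idl.
Qed.

(** Every generalized element factors through the universal one, so the algebra laws give those of a
    datum. The inverse of [r] is [j = (γ, q)], and both are maps of algebras. *)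
Lemma data_descend_essentially_surjective : data_descend -> essentially_surjective K.
Proof.
  intros HD [[Z γ] [h Hγ] A1 A2].
  assert (B1 := f_equal (fun z => proj1_sig z) A1).
  assert (B2 := f_equal (fun z => proj1_sig z) A2).
  change (Hom (pb PB p (p ∘ γ)) Z) in h.
  change (γ ∘ h = pb1 PB p (p ∘ γ)) in Hγ.
  change (h ∘ monad_unit γ = idm Z) in B1.
  change (h ∘ counit_act (p ∘ γ) = h ∘ monad_map Hγ) in B2.
  destruct (HD Z γ h) as [D [d [q [r [Hd [Hq [Hr1 [Hr2 Hrc]]]]]]]].
  { split; [exact Hγ | split].
    - intros Q u c H1 H2.
      assert (Eu : u = monad_unit γ ∘ c).
      { apply pb_ext; rewrite comp_assoc; [rewrite monad_unit1; exact H1 |].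
        rewrite monad_unit2, comp_idl; exact H2. }
      rewrite Eu, comp_assoc, B1; apply comp_idl.
    - intros Q u v w H1 H2 H3.
      assert (L : p ∘ (pb1 PB p (p ∘ γ) ∘ u) = (p ∘ pb1 PB p (p ∘ γ)) ∘ w)
        by (rewrite comp_assoc, !pb_comm, <- !comp_assoc, H2; reflexivity).
      assert (Eu : u = counit_act (p ∘ γ) ∘ pb_lift PB L).
      { apply pb_ext; rewrite comp_assoc.
        - rewrite counit_act1, pb_lift1; reflexivity.
        - rewrite counit_act2, <- comp_assoc, pb_lift2; exact H2. }
      assert (Ev : v = monad_map Hγ ∘ pb_lift PB L).
      { apply pb_ext; rewrite comp_assoc.
        - rewrite monad_map1, pb_lift1; symmetry; exact H1.
        - rewrite monad_map2, <- comp_assoc, pb_lift2; exact H3. }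
      rewrite Eu, Ev, !comp_assoc, B2; reflexivity. }
  exists (Build_SliceOb d).
  (* The uniqueness clause for [r] reduces equivariance to comparing coordinates in [E] and in
     [D]. *)
  assert (Lr : r ∘ counit_act d = h ∘ monad_map Hr1).
  { apply Hrc.
    - rewrite counit_act1, comp_assoc, Hγ, monad_map1; reflexivity.
    - rewrite counit_act2, comp_assoc, Hq, <- comp_assoc, monad_map2, comp_assoc, Hr2.
      reflexivity. }
  pose (j := pb_lift PB (eq_sym Hd) : Hom Z (pb PB p d)).
  assert (Hj : pb1 PB p d ∘ j = γ) by apply pb_lift1.
  assert (Hj2 : pb2 PB p d ∘ j = q) by apply pb_lift2.
  clearbody j.
  assert (Lj : j ∘ h = counit_act d ∘ monad_map Hj).
  { apply pb_ext; rewrite !comp_assoc.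
    - rewrite counit_act1, monad_map1, Hj; exact Hγ.
    - rewrite counit_act2, <- (comp_assoc _ _ (monad_map Hj)), monad_map2.
      rewrite comp_assoc, Hj2; exact Hq. }
  assert (Rj : r ∘ j = idm Z) by (apply Hrc; rewrite comp_idr; assumption).
  assert (Jr : j ∘ r = idm _).
  { apply pb_ext; rewrite comp_assoc, comp_idr; [rewrite Hj; exact Hr1 |].
    rewrite Hj2; exact Hr2. }
  pose (x := {| alg_ob := Build_SliceOb γ : Slice E; alg_act :=
    (exist _ h Hγ : @SliceHom C E (T (Build_SliceOb γ)) (Build_SliceOb γ));
    alg_unit := A1; alg_assoc := A2 |} : Algebra T).
  pose (y := K (Build_SliceOb d) : Algebra T).
  pose (r' := exist _ r Hr1 : Hom (alg_ob y) (alg_ob x)).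
  pose (j' := exist _ j Hj : Hom (alg_ob x) (alg_ob y)).
  assert (Lr' : r' ∘ alg_act y = alg_act x ∘ fmap T r') by (apply sig_eq; exact Lr).
  assert (Lj' : j' ∘ alg_act x = alg_act y ∘ fmap T j') by (apply sig_eq; exact Lj).
  exists (exist _ r' Lr'), (exist _ j' Lj'); split; apply sig_eq; apply sig_eq; assumption.
Qed.

Lemma effective_descent_iff :
  effective_descent PB p <-> maps_descend /\ data_descend.
Proof.
  split.
  - intros H; split.
    + apply comparison_fully_faithful, equivalence_fully_faithful, H.
    + apply comparison_essentially_surjective, equivalence_essentially_surjective, H.
  - intros [HM HD]; apply equivalence_intro.
    + apply maps_descend_fully_faithful, HM.
    + apply data_descend_essentially_surjective, HD.
Qed.
End Descent.

(** * Regular epimorphisms *)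

(** The pair that [f] coequalizes factors through the kernel pair, so any map coequalizing the
    kernel pair coequalizes it too. *)
Lemma regular_epi_kernel_pair (C : Category) (PB : Pullbacks C) (E B : C) (f : Hom E B) :
  regular_epi C f -> is_coequalizer (pb1 PB f f) (pb2 PB f f) f.
Proof.
  intros [K [u [v [Huv H]]]]; split; [apply pb_comm |].
  intros Z h Hh; apply H.
  destruct (pb_lift_ex PB Huv) as [k [<- <-]].
  rewrite !comp_assoc, Hh; reflexivity.
Qed.

(** Transport along the comparison [i : P' -> P]. It lets stability be tested on explicitly
    constructed pullbacks. *)
Lemma regular_epi_pullback_unique (C : Category) (E Z B P P' : C)
    (f : Hom E B) (g : Hom Z B) (p1 : Hom P E) (p2 : Hom P Z)
    (p1' : Hom P' E) (p2' : Hom P' Z) :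
  is_pullback f g p1 p2 -> is_pullback f g p1' p2' ->
  regular_epi C p2' -> regular_epi C p2.
Proof.
  intros [Hc H] [Hc' H'] [K [u [v [Huv HK]]]].
  destruct (H _ p1' p2' Hc') as [i [[I1 I2] _]].
  destruct (H' _ p1 p2 Hc) as [j [[J1 J2] _]].
  destruct (H _ p1 p2 Hc) as [o [_ Uo]].
  assert (Eij : i ∘ j = idm P).
  { transitivity o; [symmetry |]; apply Uo; rewrite ?comp_assoc, ?I1, ?I2, ?comp_idr; auto. }
  exists K, (i ∘ u), (i ∘ v); split.
  - rewrite !comp_assoc, I2; exact Huv.
  - intros W h Hh; rewrite !comp_assoc in Hh.
    destruct (HK W (h ∘ i) Hh) as [k [Ek Uk]]; exists k; split.
    + rewrite <- J2, comp_assoc, Ek, <- comp_assoc, Eij; apply comp_idr.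
    + intros k' Ek'; apply Uk; rewrite <- Ek', <- comp_assoc, I2; reflexivity.
Qed.

Lemma mono_app (A B : Poset) (f g : Mono A B) : f = g -> forall x, f x = g x.
Proof. intros -> x; reflexivity. Qed.

Lemma lax_app (X : Poset) (A B : LaxOb X) (f g : LaxHom A B) :
  f = g -> forall x, lax_fn f x = lax_fn g x.
Proof. intros -> x; reflexivity. Qed.

Lemma le_of_eq (P : Poset) (x y : P) : x = y -> x ≤ y.
Proof. intros ->; apply le_refl. Qed.

Lemma point_order : order unit (fun _ _ => True).
Proof. split; [intros ? | intros ? ? ? _ _ | intros [] [] _ _]; trivial. Qed.

(** Monotone maps out of it are elements, so it turns laws on generalized elements into laws on
    elements. *)
Definition point : Poset := {| le_order := point_order |}.

Definition const (A B : Poset) (b : B) : Mono A B :=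
  {| mfn := fun _ => b; monotone := fun _ _ _ => le_refl b |}.

Lemma Prop_order : order Prop (fun P Q => P -> Q).
Proof.
  split; [intros P; tauto | intros P Q R; tauto |].
  intros P Q H1 H2; apply propositional_extensionality; tauto.
Qed.

(** Monotone maps into it are up-sets, which serve to test whether a map is an epimorphism. *)
Definition PropP : Poset := {| le_order := Prop_order |}.

Lemma coequalizer_epi (C : Category) (K E B Z : C) (u v : Hom K E) (f : Hom E B)
    (k l : Hom B Z) :
  is_coequalizer u v f -> k ∘ f = l ∘ f -> k = l.
Proof.
  intros [Huv H] Hkl; destruct (H Z (l ∘ f)) as [m [_ Um]].
  { rewrite <- !comp_assoc, Huv; reflexivity. }
  rewrite <- (Um k Hkl); apply Um; reflexivity.
Qed.

(** The up-sets [{x | b ≤ x}] and [{x | b < x}] agree on the image of [f] when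
    [b] is not in it. *)
Lemma pos_regular_epi_surjective (A B : Poset) (f : Mono A B) :
  regular_epi Pos (f : @Hom Pos A B) -> forall b, exists a, f a = b.
Proof.
  intros [K [u [v Hf]]] b; apply NNPP; intros Hb.
  assert (L : forall x y : B, x ≤ y -> b ≤ x /\ x <> b -> b ≤ y /\ y <> b).
  { intros x y Hxy [Hx Hn]; split; [apply le_trans with x; assumption |].
    intros ->; apply Hn, le_antisym; assumption. }
  pose (k := {| mfn := fun x : B => b ≤ x : PropP;
    monotone := fun x y H (Hx : b ≤ x) => le_trans Hx H |} : Mono B PropP).
  pose (l := {| mfn := fun x : B => b ≤ x /\ x <> b : PropP; monotone := L |}
    : Mono B PropP).
  assert (E : k = l).
  { apply (@coequalizer_epi Pos _ _ _ _ u v f k l Hf); apply mono_eq; intros a; simpl.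
    apply propositional_extensionality; split; [| tauto].
    intros Ha; split; [exact Ha |]; intros Hab; apply Hb; exists a; exact Hab. }
  assert (Eb := mono_app E b); simpl in Eb.
  destruct (eq_ind _ (fun P : Prop => P) (le_refl b) _ Eb) as [_ []]; reflexivity.
Qed.

(** * Joins and meets below a fixed element *)

Section Joins.
Context (X : Poset) (hX : locally_complete X).

Lemma join_in_spec (x : X) (I : Type) (P : I -> Prop) (F : I -> X) :
  exists u : down x, is_lub (fun u : down x => exists i, P i /\ F i = proj1_sig u) u /\
    join_in x P F = proj1_sig u.
Proof.
  unfold join_in; eexists; split; [| reflexivity].
  apply epsilon_spec, hX.
Qed.

Lemma join_in_le (x : X) (I : Type) (P : I -> Prop) (F : I -> X) : join_in x P F ≤ x.
Proof. unfold join_in; apply proj2_sig. Qed.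

Lemma join_in_ub (x : X) (I : Type) (P : I -> Prop) (F : I -> X) (i : I) :
  P i -> F i ≤ x -> F i ≤ join_in x P F.
Proof.
  intros Hi HF; destruct (join_in_spec x P F) as [u [[Hu _] ->]].
  apply (Hu (exist _ (F i) HF)); exists i; auto.
Qed.

Lemma join_in_lub (x : X) (I : Type) (P : I -> Prop) (F : I -> X) (t : X) :
  t ≤ x -> (forall i, P i -> F i ≤ t) -> join_in x P F ≤ t.
Proof.
  intros Ht H; destruct (join_in_spec x P F) as [u [[_ Hu] ->]].
  apply (Hu (exist _ t Ht)); intros [y Hy] [i [Hi Ei]]; simpl in *; subst; auto.
Qed.

(** In contrast to [join_in_lub], the bound [t] may lie outside [down x], so [local_joins_are_joins]
    enters. That property leaves out empty joins, whence the required index. *)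
Lemma join_in_lub_global (hJ : local_joins_are_joins X) (x : X) (I : Type)
    (P : I -> Prop) (F : I -> X) (t : X) :
  (exists i, P i /\ F i ≤ x) -> (forall i, P i -> F i ≤ t) -> join_in x P F ≤ t.
Proof.
  intros [i [Hi HF]] H; destruct (join_in_spec x P F) as [u [Hu ->]].
  refine (proj2 (hJ _ _ _ _ Hu) t _).
  - exists (exist _ (F i) HF), i; auto.
  - intros y [[y' Hy'] [[j [Hj Ej]] ->]]; simpl in *; subst; auto.
Qed.

Lemma join_in_eq (x : X) (I : Type) (P : I -> Prop) (F : I -> X) (w : X) :
  w ≤ x -> (forall i, P i -> F i ≤ w) -> w ≤ join_in x P F -> w = join_in x P F.
Proof. intros Hw H1 H2; apply le_antisym; [exact H2 | apply join_in_lub; assumption]. Qed.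

Lemma meet_comm_le (x y z : X) : y ≤ x -> z ≤ x -> y ∧ z ≤ z ∧ y.
Proof.
  intros Hy Hz; apply (le_meet hX Hz Hy); [apply (meet_ler hX Hy Hz) | apply (meet_lel hX Hy Hz)].
Qed.

End Joins.

(** * Regular and stable regular epimorphisms in [Pos//X] *)

Section RegularEpi.
Context (X : Poset) (hX : locally_complete X) (hJ : local_joins_are_joins X).

(** Forgetting decorations preserves the coequalizer, and the join is the least decoration of [B]
    making [f] lax, so the universal property forces [β] to be it. Conversely, a factorization [k]
    in [Pos] is lax because [ζ (k b)] bounds all the values that [β b] joins. *)
Lemma lax_regular_epi_iff (A B : LaxOb X) (F : LaxHom A B) :
  regular_epi (PosLax X) (F : @Hom (PosLax X) A B) <->
  regular_epi Pos (lax_fn F : @Hom Pos _ _) /\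
  forall b, lax_map B b = ⋁[lax_map B b]_(a | lax_fn F a ≤ b) lax_map A a.
Proof.
  destruct A as [A α], B as [B β], F as [f hf]; simpl in *.
  set (F := Build_LaxHom (Build_LaxOb α) (Build_LaxOb β) f hf).
  assert (Hle : forall a b, f a ≤ b -> α a ≤ β b)
    by (intros a b H; apply le_trans with (β (f a)); [apply hf | apply monotone, H]).
  split.
  - intros [K [u [v HF]]].
    assert (Hf : @is_coequalizer Pos _ _ _ (lax_fn u) (lax_fn v) f).
    { split; [apply mono_eq; exact (lax_app (proj1 HF)) |].
      intros Z h Hh.
      (* [Z] need not map to [X], but [B × Z] does *)
      pose (BZ := Build_LaxOb {| mfn := fun p : prodP B Z => β (fst p);
        monotone := fun p q H => monotone β (proj1 H) |}).
      pose (pair := fun (D : Poset) (k : Mono D B) (l : Mono D Z) =>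
        {| mfn := fun x => (k x, l x) : prodP B Z;
           monotone := fun x y H => conj (monotone k H) (monotone l H) |}).
      destruct (proj2 HF BZ (Build_LaxHom (Build_LaxOb α) BZ (pair A f h) hf))
        as [k [Ek _]].
      { apply lax_eq; intros x; simpl; f_equal; [exact (lax_app (proj1 HF) x) |].
        exact (mono_app Hh x). }
      exists {| mfn := fun b => snd (lax_fn k b);
        monotone := fun x y H => proj2 (monotone (lax_fn k) H) |}; split.
      - apply mono_eq; intros a; simpl.
        change (snd (lax_fn k (lax_fn F a)) = h a).
        exact (f_equal snd (lax_app Ek a)).
      - intros l El; apply mono_eq; intros b; simpl.
        assert (hB : forall (m : Mono B Z) b, β b ≤ lax_map BZ (pair B (idm (B : Pos)) m b))
          by (intros; apply le_refl).
        assert (E : k = Build_LaxHom (Build_LaxOb β) BZ (pair B (idm (B : Pos)) l) (hB l)).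
        { apply (coequalizer_epi HF); rewrite Ek; apply lax_eq; intros a; simpl.
          f_equal; symmetry; exact (mono_app El a). }
        rewrite E; reflexivity. }
    assert (Rf : regular_epi Pos (f : @Hom Pos A B)) by (do 3 eexists; exact Hf).
    split; [exact Rf |].
    (* The two joins are formed in different down-sets; surjectivity of [f] makes them nonempty. *)
    assert (M : forall b b', b ≤ b' -> ⋁[β b]_(a | f a ≤ b) α a ≤ ⋁[β b']_(a | f a ≤ b') α a).
    { intros b b' Hb; apply (join_in_lub_global hX hJ).
      - destruct (pos_regular_epi_surjective Rf b) as [a Ha].
        exists a; split; [apply le_of_eq, Ha | apply Hle, le_of_eq, Ha].
      - intros a Ha; assert (f a ≤ b') by (apply le_trans with b; assumption).
        apply (join_in_ub hX (P := fun a => f a ≤ b')); auto. }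
    pose (β' := {| mfn := fun b => ⋁[β b]_(a | f a ≤ b) α a; monotone := M |} : Mono B X).
    assert (hf' : forall a, α a ≤ β' (f a)).
    { intros a; apply (join_in_ub hX (P := fun a' => f a' ≤ f a)); [apply le_refl | apply hf]. }
    destruct (proj2 HF (Build_LaxOb β') (Build_LaxHom (Build_LaxOb α) (Build_LaxOb β') f hf'))
      as [k [Ek _]].
    { apply lax_eq; exact (lax_app (proj1 HF)). }
    intros b.
    (* Since [f] is surjective, [k] is the identity on elements, so its lax inequality reads
       [β b ≤ β' b]. *)
    assert (Ekb : lax_fn k b = b).
    { destruct (pos_regular_epi_surjective Rf b) as [a <-]; exact (lax_app Ek a). }
    apply le_antisym; [| apply join_in_le].
    assert (H := lax_le k b); rewrite Ekb in H; exact H.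
  - intros [Rf Hβ].
    assert (Hf := regular_epi_kernel_pair Pos_pullbacks Rf).
    exists (lax_pb hX F F), (lax_pb1 hX F F), (lax_pb2 hX F F); split.
    { apply (proj1 (lax_pb_spec hX F F)). }
    intros [Z ζ] h Hh.
    destruct (proj2 Hf Z (lax_fn h)) as [k [Ek Uk]].
    { apply mono_eq; exact (lax_app Hh). }
    assert (Hk : forall b, β b ≤ ζ (k b)).
    { intros b; rewrite Hβ; apply (join_in_lub_global hX hJ).
      - destruct (pos_regular_epi_surjective Rf b) as [a Ha].
        exists a; split; [apply le_of_eq, Ha | apply Hle, le_of_eq, Ha].
      - intros a Ha; apply le_trans with (ζ (lax_fn h a)); [apply (lax_le h) |].
        apply le_trans with (ζ (k (f a))).
        { apply le_of_eq, f_equal; symmetry; exact (mono_app Ek a). }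
        apply monotone, (monotone k), Ha. }
    exists (Build_LaxHom (Build_LaxOb β) (Build_LaxOb ζ) k Hk); split.
    + apply lax_eq; exact (mono_app Ek).
    + intros l El; apply lax_eq; apply mono_app; apply Uk, mono_eq; exact (lax_app El).
Qed.

Lemma lax_stable_regular_epi_iff (A B : Poset) (α : Mono A X) (β : Mono B X)
    (f : Mono A B) (hf : forall a, α a ≤ β (f a)) :
  stable_regular_epi (PosLax X) (Build_LaxHom (Build_LaxOb α) (Build_LaxOb β) f hf
    : @Hom (PosLax X) (Build_LaxOb α) (Build_LaxOb β)) <->
  stable_regular_epi Pos (f : @Hom Pos A B) /\
  forall b w, w ≤ β b -> w = ⋁[β b]_(a | f a = b) (w ∧ α a).
Proof.
  set (F := Build_LaxHom (Build_LaxOb α) (Build_LaxOb β) f hf).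
  split.
  - intros HF; split.
    + intros Z P g p1 p2 HP.
      apply (regular_epi_pullback_unique HP (pos_pb_spec f g)).
      (* Decorating [Z] by [β] along [g] makes any monotone [g] a morphism of [Pos//X], so the
         pullback in [Pos] underlies one there. *)
      pose (ζ := {| mfn := fun z => β ((g : Mono Z B) z);
        monotone := fun x y H => monotone β (monotone (g : Mono Z B) H) |} : Mono Z X).
      pose (G := Build_LaxHom (Build_LaxOb ζ) (Build_LaxOb β) g (fun z => le_refl _)).
      exact (proj1 (proj1 (lax_regular_epi_iff _) (HF _ _ G _ _ (lax_pb_spec hX F G)))).
    + intros b w Hw.
      (* The pullback along the point [b] decorated by [w] is the fibre of [b] decorated by
         [α a ∧ w]; the join over it must be [w]. *)
      pose (G := Build_LaxHom (Build_LaxOb (const point w)) (Build_LaxOb β)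
        (const point b) (fun _ => Hw)).
      destruct (proj1 (lax_regular_epi_iff _) (HF _ _ G _ _ (lax_pb_spec hX F G)))
        as [Rf Hj].
      specialize (Hj tt); simpl in Hj.
      assert (Ha : forall a, f a = b -> α a ≤ β b) by (intros a <-; apply hf).
      apply (join_in_eq hX Hw).
      { intros a E; apply (meet_lel hX Hw), Ha, E. }
      rewrite Hj at 1; apply (join_in_lub_global hX hJ).
      * destruct (pos_regular_epi_surjective Rf tt) as [[[a []] E] _].
        exists (exist _ (a, tt) E); split; [exact I |].
        apply (meet_ler hX (Ha a E) Hw).
      * intros [[a []] E] _; simpl in *.
        apply le_trans with (w ∧ α a); [apply (meet_comm_le hX (Ha a E) Hw) |].
        apply (join_in_ub hX (P := fun a => f a = b) (F := fun a => w ∧ α a)); [exact E |].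
        apply le_trans with w; [apply (meet_lel hX Hw (Ha a E)) | exact Hw].
  - intros [Hf Hj] [Z ζ] P g p1 p2 HP.
    apply (regular_epi_pullback_unique HP (lax_pb_spec hX F g)).
    apply lax_regular_epi_iff; split.
    + apply (Hf _ _ (lax_fn g) _ _ (pos_pb_spec f (lax_fn g))).
    + intros z; simpl.
      assert (Hw : ζ z ≤ β (lax_fn g z)) by apply (lax_le g).
      assert (Hb : forall (a : A) z, f a = lax_fn g z ->
        α a ≤ β (lax_fn g z)) by (intros a z' <-; apply hf).
      apply (join_in_eq hX); [apply le_refl | |].
      * intros [[a z'] E] Hz; simpl in *.
        apply le_trans with (ζ z'); [| apply monotone, Hz].
        apply (meet_ler hX (Hb _ _ E)), (lax_le g).
      (* For [w = ζ z] the terms of the join come from the elements [(a, z)] of the pullback, which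
         are among those lying over some [z' ≤ z]. *)
      * rewrite (Hj _ _ Hw) at 1.
        apply (join_in_lub hX); [apply le_trans with (ζ z); [apply join_in_le | exact Hw] |].
        intros a E; apply le_trans with (α a ∧ ζ z).
        { apply (meet_comm_le hX Hw), Hb, E. }
        pose (y := exist _ (a, z) E : pos_pb f (lax_fn g)).
        apply (join_in_ub hX (P := fun x : pos_pb f (lax_fn g) => snd (proj1_sig x) ≤ z)
          (F := fun x => α (fst (proj1_sig x)) ∧ ζ (snd (proj1_sig x))) (i := y)).
        { apply le_refl. }
        apply (meet_ler hX (Hb _ _ E) Hw).
Qed.
End RegularEpi.

(** * Descent data in terms of elements *)

Definition compM (A B C : Poset) (g : Mono B C) (f : Mono A B) : Mono A C :=
  @comp Pos A B C g f.

Definition pos_datum (A B Z : Poset) (f : Mono A B) (γ : Mono Z A)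
    (h : Mono (pos_pb f (compM f γ)) Z) : Prop :=
  (forall z, γ (h z) = pos_pb1 f (compM f γ) z) /\
  (forall z, pos_pb1 f (compM f γ) z = γ (pos_pb2 f (compM f γ) z) ->
     h z = pos_pb2 f (compM f γ) z) /\
  (forall z z' y, pos_pb1 f (compM f γ) z = pos_pb1 f (compM f γ) z' ->
     pos_pb2 f (compM f γ) z = pos_pb2 f (compM f γ) y ->
     pos_pb2 f (compM f γ) z' = h y -> h z = h z').

Definition pos_maps_descend (A B : Poset) (f : Mono A B) : Prop :=
  forall (D D' : Poset) (d : Mono D B) (d' : Mono D' B) (h : Mono (pos_pb f d) D'),
    (forall z, d' (h z) = d (pos_pb2 f d z)) ->
    (forall z z', pos_pb2 f d z = pos_pb2 f d z' -> h z = h z') ->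
    exists! k : Mono D D', (forall x, d' (k x) = d x) /\ (forall z, k (pos_pb2 f d z) = h z).

Definition pos_data_descend (A B : Poset) (f : Mono A B) : Prop :=
  forall (Z : Poset) (γ : Mono Z A) (h : Mono (pos_pb f (compM f γ)) Z), pos_datum h ->
    exists (D : Poset) (d : Mono D B) (q : Mono Z D) (r : Mono (pos_pb f d) Z),
      (forall c, d (q c) = f (γ c)) /\ (forall z, q (h z) = q (pos_pb2 f (compM f γ) z)) /\
      (forall z, γ (r z) = pos_pb1 f d z) /\ (forall z, q (r z) = pos_pb2 f d z) /\
      (forall z c, pos_pb1 f d z = γ c -> pos_pb2 f d z = q c -> r z = c).

Section PosDescent.
Context (A B : Poset) (f : Mono A B).

(** Testing at [point] gives the laws on elements; they suffice because equality of monotone maps is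
    pointwise. *)
Lemma pos_datum_iff (Z : Poset) (γ : Mono Z A) (h : Mono (pos_pb f (compM f γ)) Z) :
  @descent_datum Pos Pos_pullbacks A B f Z γ h <-> pos_datum h.
Proof.
  split; intros [H1 [H2 H3]].
  - split; [exact (mono_app H1) | split].
    + intros z Hz.
      refine (mono_app (H2 point (const point z) (const point (pos_pb2 f (compM f γ) z))
        _ _) tt); apply mono_eq; intros ?; [exact Hz | reflexivity].
    + intros z z' y E1 E2 E3.
      refine (mono_app (H3 point (const point z) (const point z') (const point y)
        _ _ _) tt); apply mono_eq; intros ?; assumption.
  - split; [apply mono_eq; exact H1 | split].
    + intros Q u c E1 E2; apply mono_eq; intros x.
      assert (E2x := mono_app E2 x); simpl in E2x.
      transitivity (pos_pb2 f (compM f γ) (u x)); [| exact E2x].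
      apply H2; etransitivity; [exact (mono_app E1 x) |].
      simpl; f_equal; symmetry; exact E2x.
    + intros Q u v w E1 E2 E3; apply mono_eq; intros x.
      exact (H3 (u x) (v x) (w x) (mono_app E1 x) (mono_app E2 x) (mono_app E3 x)).
Qed.

Lemma pos_maps_descend_iff :
  @maps_descend Pos Pos_pullbacks A B f <-> pos_maps_descend f.
Proof.
  split; intros H D D' d d' h H1 H2.
  - destruct (H D D' d d' h) as [k [[K1 K2] Uk]].
    { apply mono_eq; exact H1. }
    { intros Q u v E; apply mono_eq; intros x; exact (H2 (u x) (v x) (mono_app E x)). }
    exists k; split; [exact (conj (mono_app K1) (mono_app K2)) |].
    intros k' [K1' K2']; apply Uk; split; apply mono_eq; assumption.
  - destruct (H D D' d d' h (mono_app H1)) as [k [[K1 K2] Uk]].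
    { intros z z' E; refine (mono_app (H2 point (const point z) (const point z') _) tt).
      apply mono_eq; intros ?; exact E. }
    exists k; split; [split; apply mono_eq; assumption |].
    intros k' [K1' K2']; apply Uk; exact (conj (mono_app K1') (mono_app K2')).
Qed.

Lemma pos_data_descend_iff :
  @data_descend Pos Pos_pullbacks A B f <-> pos_data_descend f.
Proof.
  split; intros H Z γ h Hh; apply pos_datum_iff in Hh.
  - destruct (H Z γ h Hh) as [D [d [q [r [H1 [H2 [H3 [H4 H5]]]]]]]].
    exists D, d, q, r; repeat split;
      [exact (mono_app H1) | exact (mono_app H2) | exact (mono_app H3) | exact (mono_app H4) |].
    intros z c E1 E2.
    refine (mono_app (H5 point (const point z) (const point c) _ _) tt);
      apply mono_eq; intros ?; assumption.
  - destruct (H Z γ h Hh) as [D [d [q [r [H1 [H2 [H3 [H4 H5]]]]]]]].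
    exists D, d, q, r; repeat split;
      [apply mono_eq; exact H1 | apply mono_eq; exact H2 | apply mono_eq; exact H3 | apply mono_eq; exact H4 |].
    intros Q u c E1 E2; apply mono_eq; intros x.
    exact (H5 (u x) (c x) (mono_app E1 x) (mono_app E2 x)).
Qed.

Lemma pos_effective_descent_iff :
  effective_descent Pos_pullbacks (f : @Hom Pos A B)
  <-> pos_maps_descend f /\ pos_data_descend f.
Proof.
  split.
  - intros H; apply effective_descent_iff in H as [HM HD]; split;
      [apply pos_maps_descend_iff, HM | apply pos_data_descend_iff, HD].
  - intros [HM HD]; apply effective_descent_iff; split;
      [apply pos_maps_descend_iff, HM | apply pos_data_descend_iff, HD].
Qed.

End PosDescent.

(** * Descent data in [Pos//X] as decorated data in [Pos] *)

Section LaxDescentData.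
Context (X : Poset) (hX : locally_complete X) (A B : Poset) (α : Mono A X) (β : Mono B X)
  (f : Mono A B) (hf : forall a : A, α a ≤ β (f a)).

Let F := Build_LaxHom (Build_LaxOb α) (Build_LaxOb β) f hf.

Definition lax_maps_descend : Prop :=
  forall (D D' : Poset) (d : Mono D B) (d' : Mono D' B) (δ : Mono D X) (δ' : Mono D' X)
      (h : Mono (pos_pb f d) D'),
    (forall x, δ x ≤ β (d x)) -> (forall x, δ' x ≤ β (d' x)) ->
    (forall z, α (pos_pb1 f d z) ∧ δ (pos_pb2 f d z) ≤ δ' (h z)) ->
    (forall z, d' (h z) = d (pos_pb2 f d z)) ->
    (forall z z', pos_pb2 f d z = pos_pb2 f d z' -> h z = h z') ->
    exists! k : Mono D D', (forall x, δ x ≤ δ' (k x)) /\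
      (forall x, d' (k x) = d x) /\ (forall z, k (pos_pb2 f d z) = h z).

Definition lax_data_descend : Prop :=
  forall (Z : Poset) (γ : Mono Z A) (h : Mono (pos_pb f (compM f γ)) Z) (θ : Mono Z X),
    pos_datum h -> (forall c, θ c ≤ α (γ c)) ->
    (forall z, α (pos_pb1 f (compM f γ) z) ∧ θ (pos_pb2 f (compM f γ) z) ≤ θ (h z)) ->
    exists (D : Poset) (d : Mono D B) (δ : Mono D X) (q : Mono Z D) (r : Mono (pos_pb f d) Z),
      (forall x, δ x ≤ β (d x)) /\ (forall c, θ c ≤ δ (q c)) /\
      (forall z, α (pos_pb1 f d z) ∧ δ (pos_pb2 f d z) ≤ θ (r z)) /\
      (forall c, d (q c) = f (γ c)) /\ (forall z, q (h z) = q (pos_pb2 f (compM f γ) z)) /\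
      (forall z, γ (r z) = pos_pb1 f d z) /\ (forall z, q (r z) = pos_pb2 f d z) /\
      (forall z c, pos_pb1 f d z = γ c -> pos_pb2 f d z = q c -> r z = c).

(** Equality of morphisms in [Pos//X] is equality of underlying maps. To test a law on elements,
    [point] is decorated low enough for all the elements in the law to be morphisms. *)
Lemma lax_datum_iff (Z : Poset) (γ : Mono Z A) (h : Mono (pos_pb f (compM f γ)) Z)
    (θ : Mono Z X) (hγ : forall c, θ c ≤ α (γ c)) 
    (G := Build_LaxHom (Build_LaxOb θ) (Build_LaxOb α) γ hγ : @Hom (PosLax X) _ _)
    (hH : forall z, α (pos_pb1 f (compM f γ) z) ∧ θ (pos_pb2 f (compM f γ) z) ≤ θ (h z)) :
  descent_datum (C := PosLax X) (PB := PosLax_pullbacks hX) (γ := G)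
    (Build_LaxHom (lax_pb hX F (comp (F : @Hom (PosLax X) _ _) G)) (Build_LaxOb θ) h hH)
  <-> pos_datum h.
Proof.
  simpl in hH.
  assert (Hz : forall z : pos_pb f (compM f γ),
    α (fst (proj1_sig z)) ≤ β (f (fst (proj1_sig z))) /\
    θ (snd (proj1_sig z)) ≤ β (f (fst (proj1_sig z)))).
  { intros [[a c] E]; split; [apply hf |]; simpl in *; rewrite E.
    apply le_trans with (α (γ c)); auto. }
  pose (θz := fun z : pos_pb f (compM f γ) => α (fst (proj1_sig z)) ∧ θ (snd (proj1_sig z))).
  assert (Hzβ : forall z, θz z ≤ β (f (fst (proj1_sig z)))).
  { intros z; destruct (Hz z) as [U V].
    apply le_trans with (α (fst (proj1_sig z))); [apply (meet_lel hX U V) | exact U]. }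
  split; intros [H1 [H2 H3]].
  - split; [exact (lax_app H1) | split].
    + intros z E.
      pose (u := Build_LaxHom (Build_LaxOb (const point (θz z)))
        (lax_pb hX F (comp (F : @Hom (PosLax X) _ _) G)) (const point z) (fun _ => le_refl _)).
      assert (Hc : forall x : point, θz z ≤ θ (snd (proj1_sig z))).
      { intros _; destruct (Hz z) as [U V]; apply (meet_ler hX U V). }
      pose (c := Build_LaxHom (Build_LaxOb (const point (θz z))) (Build_LaxOb θ)
        (const point (snd (proj1_sig z))) Hc).
      refine (lax_app (H2 _ u c _ _) tt); apply lax_eq; intros ?; [exact E | reflexivity].
    + intros z z' y E1 E2 E3.
      simpl in E1, E2, E3.
      assert (Ey : f (fst (proj1_sig y)) = f (fst (proj1_sig z))).
      { rewrite (proj2_sig y : f _ = f _), (proj2_sig z : f _ = f _); simpl; rewrite E2.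
        reflexivity. }
      assert (By : θz y ≤ β (f (fst (proj1_sig z)))) by (rewrite <- Ey; apply Hzβ).
      assert (Bz := Hzβ z).
      (* The meet of the decorations of [z] and [y] also lies below that of [z'], which has the
         first coordinate of [z] and second coordinate [h y]. *)
      pose (m := Build_LaxOb (const point (θz z ∧ θz y))).
      assert (Lz : θz z ∧ θz y ≤ θz z) by apply (meet_lel hX Bz By).
      assert (Ly : θz z ∧ θz y ≤ θz y) by apply (meet_ler hX Bz By).
      assert (Lz' : θz z ∧ θz y ≤ θz z').
      { destruct (Hz z) as [U V], (Hz z') as [U' V']; apply (le_meet hX U' V').
        - apply le_trans with (θz z); [exact Lz |].
          apply le_trans with (α (fst (proj1_sig z))); [apply (meet_lel hX U V) |].
          apply le_of_eq, (f_equal α E1).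
        - apply le_trans with (θz y); [exact Ly |].
          apply le_trans with (θ (h y)); [apply hH | apply le_of_eq, (f_equal θ (eq_sym E3))]. }
      pose (pt := fun w (L : θz z ∧ θz y ≤ θz w) => Build_LaxHom m
        (lax_pb hX F (comp (F : @Hom (PosLax X) _ _) G)) (const point w) (fun _ => L)).
      refine (lax_app (H3 _ (pt z Lz) (pt z' Lz') (pt y Ly) _ _ _) tt);
        apply lax_eq; intros ?; assumption.
  - split; [apply lax_eq; exact H1 | split].
    + intros Q u c E1 E2; apply lax_eq; intros x.
      assert (E2x := lax_app E2 x); simpl in E2x.
      transitivity (pos_pb2 f (compM f γ) (lax_fn u x)); [| exact E2x].
      apply H2; etransitivity; [exact (lax_app E1 x) |].
      simpl; f_equal; symmetry; exact E2x.
    + intros Q u v w E1 E2 E3; apply lax_eq; intros x.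
      exact (H3 (lax_fn u x) (lax_fn v x) (lax_fn w x)
        (lax_app E1 x) (lax_app E2 x) (lax_app E3 x)).
Qed.

Lemma lax_maps_descend_iff :
  maps_descend (PosLax_pullbacks hX) (F : @Hom (PosLax X) _ _) <-> lax_maps_descend.
Proof.
  assert (Hz : forall (D : Poset) (d : Mono D B) (δ : Mono D X), (forall x, δ x ≤ β (d x)) ->
    forall z : pos_pb f d, α (fst (proj1_sig z)) ≤ β (f (fst (proj1_sig z))) /\
    δ (snd (proj1_sig z)) ≤ β (f (fst (proj1_sig z)))).
  { intros D d δ Hδ [[a x] E]; split; [apply hf |]; simpl in *; rewrite E; apply Hδ. }
  split.
  - intros H D D' d d' δ δ' h Hδ Hδ' hh H1 H2.
    pose (G := Build_LaxHom (Build_LaxOb δ) (Build_LaxOb β) d Hδ : @Hom (PosLax X) _ _).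
    pose (G' := Build_LaxHom (Build_LaxOb δ') (Build_LaxOb β) d' Hδ' : @Hom (PosLax X) _ _).
    pose (h' := Build_LaxHom (lax_pb hX F G) (Build_LaxOb δ') h hh).
    destruct (H _ _ G G' h') as [k [[K1 K2] Uk]].
    { apply lax_eq; exact H1. }
    { intros Q u v E; apply lax_eq; intros x; exact (H2 _ _ (lax_app E x)). }
    exists (lax_fn k); split.
    + exact (conj (lax_le k) (conj (lax_app K1) (lax_app K2))).
    + intros k' [K0 [K1' K2']].
      assert (E : k = Build_LaxHom (Build_LaxOb δ) (Build_LaxOb δ') k' K0)
        by (apply Uk; split; apply lax_eq; assumption).
      rewrite E; reflexivity.
  - intros H [D δ] [D' δ'] [d Hδ] [d' Hδ'] [h hh] H1 H2.
    destruct (H D D' d d' δ δ' h Hδ Hδ' hh (lax_app H1)) as [k [[K0 [K1 K2]] Uk]].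
    { intros z z' E; simpl in E.
      pose (δz := fun z : pos_pb f d => α (fst (proj1_sig z)) ∧ δ (snd (proj1_sig z))).
      assert (Hzβ : forall z, δz z ≤ β (f (fst (proj1_sig z)))).
      { intros w; destruct (Hz _ _ _ Hδ w) as [U V].
        apply le_trans with (α (fst (proj1_sig w))); [apply (meet_lel hX U V) | exact U]. }
      assert (Ef : f (fst (proj1_sig z')) = f (fst (proj1_sig z))).
      { rewrite (proj2_sig z : f _ = d _), (proj2_sig z' : f _ = d _), E; reflexivity. }
      assert (B' : δz z' ≤ β (f (fst (proj1_sig z)))) by (rewrite <- Ef; apply Hzβ).
      (* Decorated by this meet, one point maps to both [z] and [z']. *)
      pose (pt := fun w (L : δz z ∧ δz z' ≤ δz w) =>
        Build_LaxHom (Build_LaxOb (const point (δz z ∧ δz z')))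
        (lax_pb hX F (Build_LaxHom (Build_LaxOb δ) (Build_LaxOb β) d Hδ))
        (const point w) (fun _ => L)).
      refine (lax_app (H2 _ (pt z (meet_lel hX (Hzβ z) B'))
        (pt z' (meet_ler hX (Hzβ z) B')) _) tt).
      apply lax_eq; intros ?; exact E. }
    exists (Build_LaxHom (Build_LaxOb δ) (Build_LaxOb δ') k K0); split.
    + split; apply lax_eq; assumption.
    + intros k' [K1' K2']; apply lax_eq, mono_app, Uk.
      exact (conj (lax_le k') (conj (lax_app K1') (lax_app K2'))).
Qed.

Lemma lax_data_descend_iff :
  data_descend (PosLax_pullbacks hX) (F : @Hom (PosLax X) _ _) <-> lax_data_descend.
Proof.
  split.
  - intros H Z γ h θ Hh hγ hh.
    pose (G := Build_LaxHom (Build_LaxOb θ) (Build_LaxOb α) γ hγ : @Hom (PosLax X) _ _).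
    pose (h' := Build_LaxHom (lax_pb hX F (comp (F : @Hom (PosLax X) _ _) G))
      (Build_LaxOb θ) h hh).
    destruct (H _ G h') as [[D δ] [[d Hd] [[q Hq] [[r Hr] [H1 [H2 [H3 [H4 H5]]]]]]]].
    { exact (proj2 (@lax_datum_iff Z γ h θ hγ hh) Hh). }
    exists D, d, δ, q, r.
    split; [exact Hd |]; split; [exact Hq |]; split; [exact Hr |].
    split; [exact (lax_app H1) |]; split; [exact (lax_app H2) |];
    split; [exact (lax_app H3) |]; split; [exact (lax_app H4) |].
    intros z c E1 E2; simpl in E1, E2.
    (* As [z] is [(γ c, q c)], the point decorated by [θ c] maps to both [c] and [z]. *)
    assert (Hc : θ c ≤ α (fst (proj1_sig z)) ∧ δ (snd (proj1_sig z))).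
    { rewrite E1, E2.
      apply (le_meet hX (hf (γ c))).
      - rewrite <- (lax_app H1 c : d (q c) = f (γ c)); apply Hd.
      - apply hγ.
      - apply Hq. }
    pose (u := Build_LaxHom (Build_LaxOb (const point (θ c)))
      (lax_pb hX F (Build_LaxHom (Build_LaxOb δ) (Build_LaxOb β) d Hd))
      (const point z) (fun _ => Hc)).
    pose (c' := Build_LaxHom (Build_LaxOb (const point (θ c))) (Build_LaxOb θ)
      (const point c) (fun _ => le_refl _)).
    refine (lax_app (H5 _ u c' _ _) tt); apply lax_eq; intros ?; assumption.
  - intros H [Z θ] [γ hγ] [h hh] Hh.
    apply (@lax_datum_iff Z γ h θ hγ hh) in Hh.
    destruct (H Z γ h θ Hh hγ hh) as
      [D [d [δ [q [r [Hd [Hq [Hr [H1 [H2 [H3 [H4 H5]]]]]]]]]]]].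
    pose (d' := Build_LaxHom (Build_LaxOb δ) (Build_LaxOb β) d Hd).
    exists (Build_LaxOb δ), d', (Build_LaxHom (Build_LaxOb θ) (Build_LaxOb δ) q Hq),
      (Build_LaxHom (lax_pb hX F d') (Build_LaxOb θ) r Hr).
    split; [apply lax_eq; exact H1 |]; split; [apply lax_eq; exact H2 |];
    split; [apply lax_eq; exact H3 |]; split; [apply lax_eq; exact H4 |].
    intros Q u c E1 E2; apply lax_eq; intros x.
    exact (H5 _ _ (lax_app E1 x) (lax_app E2 x)).
Qed.

Lemma lax_effective_descent_iff :
  effective_descent (PosLax_pullbacks hX) (F : @Hom (PosLax X) _ _)
  <-> lax_maps_descend /\ lax_data_descend.
Proof.
  split.
  - intros H; apply effective_descent_iff in H as [HM HD]; split;
      [apply lax_maps_descend_iff, HM | apply lax_data_descend_iff, HD].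
  - intros [HM HD]; apply effective_descent_iff; split;
      [apply lax_maps_descend_iff, HM | apply lax_data_descend_iff, HD].
Qed.

End LaxDescentData.

(** * Effective descent in lax comma categories *)

Lemma two_order : order bool (fun i j => i = true -> j = true).
Proof.
  split; [intros i; auto | intros i j k; auto |].
  intros [] [] H1 H2; try reflexivity; [discriminate (H1 eq_refl) | discriminate (H2 eq_refl)].
Qed.

(** The shape of an inequality: monotone maps out of it are comparable pairs. *)
Definition two : Poset := {| le_order := two_order |}.

Lemma fiber_order (A B : Poset) (f : A -> B) :
  order A (fun a a' => a ≤ a' /\ f a = f a').
Proof.
  split.
  - intros a; split; [apply le_refl | reflexivity].
  - intros a b c [H1 E1] [H2 E2]; split; [apply le_trans with b; assumption | congruence].
  - intros a b [H1 _] [H2 _]; apply le_antisym; assumption.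
Qed.

(** The disjoint union of the fibres of [f]. A compatible family is monotone for this order, though
    perhaps not for that of [A]. *)
Definition fiberP (A B : Poset) (f : A -> B) : Poset := {| le_order := fiber_order f |}.

Section LaxDescent.
Context (X : Poset) (hX : locally_complete X) (A B : Poset) (α : Mono A X) (β : Mono B X)
  (f : Mono A B) (hf : forall a : A, α a ≤ β (f a)).

Local Lemma fiber_le (a : A) (b : B) : f a = b -> α a ≤ β b.
Proof. intros <-; apply hf. Qed.

Definition chain_join_condition : Prop :=
  forall (b0 b1 : B) (w : X), b0 ≤ b1 -> w ≤ β b0 ->
    w = ⋁[β b0]_(p | fst p ≤ snd p /\ f (fst p) = b0 /\ f (snd p) = b1) (w ∧ α (fst p)).

Definition compatible_family (σ : A -> X) : Prop :=
  (forall a : A, σ a ≤ α a) /\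
  (forall (b : B) (a a' : A), f a = b -> f a' = b -> σ a' ∧ α a ≅ α a' ∧ σ a).

Definition gluing_condition : Prop :=
  forall σ : A -> X, compatible_family σ ->
    forall (b : B) (a' : A), f a' = b -> α a' ∧ (⋁[β b]_(a | f a = b) σ a) ≅ σ a'.

(** With [D] and [D'] decorated by [β], every map over [B] is lax. *)
Lemma lax_maps_pos_maps : lax_maps_descend α β f -> pos_maps_descend f.
Proof.
  intros H D D' d d' h H1 H2.
  destruct (H D D' d d' (compM β d) (compM β d') h) as [k [[_ K] Uk]];
    try (intros; apply le_refl).
  - intros [[a x] E]; simpl in *; rewrite (H1 (exist _ (a, x) E)); simpl.
    apply (meet_ler hX (fiber_le E)), le_refl.
  - exact H1.
  - exact H2.
  - exists k; split; [exact K |].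
    intros k' K'; apply Uk; split; [| exact K'].
    intros x; simpl; apply le_of_eq, f_equal; symmetry; apply K'.
Qed.

(** With [Z] decorated by [α] along [γ], every action is lax, since [γ (a · c) = a]. *)
Lemma lax_data_pos_data : lax_data_descend α β f -> pos_data_descend f.
Proof.
  intros H Z γ h Hh.
  destruct (H Z γ h (compM α γ) Hh) as [D [d [δ [q [r [_ [_ [_ K]]]]]]]].
  - intros c; apply le_refl.
  - intros [[a c] E].
    apply le_trans with (α a); [apply (meet_lel hX (fiber_le E)), hf |].
    apply le_of_eq, (f_equal α); symmetry; apply (proj1 Hh).
  - exists D, d, q, r; exact K.
Qed.

(** View [x] and [y] as two decorations of a point over [b]. The hypothesis makes the identity lax
    after pullback; it descends, and its lax inequality is [x ≤ y]. *)
Lemma lax_maps_reflect_le (b : B) (x y : X) :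
  lax_maps_descend α β f -> x ≤ β b -> y ≤ β b ->
  (forall a, f a = b -> α a ∧ x ≤ y) -> x ≤ y.
Proof.
  intros H Hx Hy Hxy.
  destruct (H point point (const point b) (const point b) (const point x) (const point y)
    (const _ (tt : point))) as [k [[K _] _]]; auto.
  - intros [[a u] E]; apply Hxy, E.
  - exact (K tt).
Qed.

Lemma lax_data_gluing : lax_data_descend α β f -> gluing_condition.
Proof.
  intros H σ [Hσ Hc].
  pose (Z := fiberP f).
  pose (γ := {| mfn := fun a : Z => a : A; monotone := fun a a' L => proj1 L |} : Mono Z A).
  (* Here [σ a ≤ α a' ∧ σ a], and compatibility turns this meet into [σ a' ∧ α a]. *)
  assert (Mσ : forall a a' : Z, a ≤ a' -> σ a ≤ σ a').
  { intros a a' [L E].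
    assert (Hb := fiber_le (eq_sym E)); assert (Hb' := hf a).
    apply le_trans with (α a' ∧ σ a).
    - apply (le_meet hX Hb); [apply le_trans with (α a); auto | | apply le_refl].
      apply le_trans with (α a); [apply Hσ | apply monotone, L].
    - apply le_trans with (σ a' ∧ α a); [apply (Hc (f a)); auto |].
      apply (meet_lel hX (x := β (f a))); [apply le_trans with (α a'); auto | exact Hb']. }
  pose (θ := @Build_Mono Z X σ Mσ).
  assert (Mh : forall z z' : pos_pb f (compM f γ), z ≤ z' ->
    (fst (proj1_sig z) : Z) ≤ fst (proj1_sig z')).
  { intros [[a c] E] [[a' c'] E'] [L [_ Lc]]; split; [exact L |].
    simpl in *; congruence. }
  (* The action is [a · c = a], and compatibility of [σ] makes it lax. *)
  pose (h := @Build_Mono (pos_pb f (compM f γ)) Z (fun z => fst (proj1_sig z)) Mh).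
  destruct (H Z γ h θ) as [D [d [δ [q [r [Hd [Hq [Hr [H1 [H2 [H3 [H4 H5]]]]]]]]]]]].
  - split; [reflexivity | split]; [intros z Hz; exact Hz | intros z z' y E _ _; exact E].
  - exact Hσ.
  - intros [[a c] E]; simpl in *.
    assert (Hb := hf c); assert (Hb' := fiber_le E).
    apply le_trans with (α c ∧ σ a).
    { apply le_trans with (σ c ∧ α a); [| apply (Hc (f a)); auto].
      apply (meet_comm_le hX Hb'), le_trans with (α c); auto. }
    apply (meet_ler hX Hb), le_trans with (α a); auto.
  - intros b a' E.
    assert (Ha' := fiber_le E).
    split.
    + apply le_trans with (α a' ∧ δ (q a')).
      * assert (Hdb : δ (q a') ≤ β b).
        { apply le_trans with (β (d (q a'))); [apply Hd |].
          rewrite H1; apply le_of_eq, f_equal, E. }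
        apply (le_meet hX Ha' Hdb); [apply (meet_lel hX Ha'), join_in_le |].
        apply le_trans with (⋁[β b]_(a | f a = b) σ a);
          [apply (meet_ler hX Ha'), join_in_le |].
        apply (join_in_lub hX Hdb); intros a Ea.
        apply le_trans with (δ (q a)); [apply (Hq a) |].
        (* [q] is constant on fibres: [a · a' = a], and [q] is invariant under the action. Hence
           [δ (q a')] bounds the join. *)
        assert (Eaa : f a = f a') by congruence.
        apply le_of_eq, f_equal; exact (H2 (exist _ (a : A, a' : Z) Eaa)).
      * assert (Ex : f a' = d (q a')) by (rewrite H1; reflexivity).
        assert (Hz := Hr (exist _ (a', q a') Ex)); simpl in Hz.
        rewrite (H5 (exist _ (a', q a') Ex) a' eq_refl eq_refl) in Hz; exact Hz.
    + apply (le_meet hX Ha'); [apply join_in_le | apply Hσ |].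
      apply (join_in_ub hX (P := fun a => f a = b)); [exact E |].
      apply le_trans with (α a'); auto.
Qed.

(** Given [b0 ≤ b1] and [w], let [v] be the join: the datum is [A ×_B two] over
    the chain [b0 ≤ b1], decorated with [α a ∧ w] above [b0] and [α a ∧ v] above
    [b1]. It descends to a decoration of [two], whose monotonicity reads [w ≤ v]. *)
Lemma lax_descent_chain_join :
  lax_maps_descend α β f -> lax_data_descend α β f -> chain_join_condition.
Proof.
  intros HM HD b0 b1 w Hb Hw.
  set (v := ⋁[β b0]_(p | _) _).
  assert (Hv0 : v ≤ β b0) by apply join_in_le.
  assert (Hv1 : v ≤ β b1) by (apply le_trans with (β b0); [exact Hv0 | apply monotone, Hb]).
  assert (Hwb : forall a, f a = b0 -> w ∧ α a ≤ w) by (intros a E; apply (meet_lel hX Hw), fiber_le, E).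
  apply le_antisym; [| apply (join_in_lub hX Hw); intros p [_ [E _]]; apply Hwb, E].
  pose (e := fun i : bool => if i then b1 else b0).
  pose (x := fun i : bool => if i then v else w).
  assert (Me : forall i j : two, i ≤ j -> e i ≤ e j).
  { intros [] [] L; try apply le_refl; [discriminate (L eq_refl) | exact Hb]. }
  pose (d := @Build_Mono two B e Me).
  assert (Hx : forall i, x i ≤ β (e i)) by (intros []; assumption).
  pose (Z := pos_pb f d).
  assert (HZ : forall z : Z, α (fst (proj1_sig z)) ≤ β (e (snd (proj1_sig z))))
    by (intros [[a i] E]; apply fiber_le, E).
  assert (Mθ : forall z z' : Z, z ≤ z' ->
    α (fst (proj1_sig z)) ∧ x (snd (proj1_sig z))
    ≤ α (fst (proj1_sig z')) ∧ x (snd (proj1_sig z'))).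
  { intros z z' L.
    apply (le_meet hX (HZ z') (Hx _)).
    - apply le_trans with (α (fst (proj1_sig z))); [apply (meet_lel hX (HZ z)), Hx |].
      apply monotone, (proj1 L).
    - assert (Lz := meet_ler hX (HZ z) (Hx (snd (proj1_sig z)))).
      destruct z as [[a i] E], z' as [[a' i'] E'], L as [La Li]; simpl in *.
      destruct i, i'; simpl in *; try exact Lz; [discriminate (Li eq_refl) |].
      (* Only the passage from [b0] to [b1] is not immediate: [(a, a')] is one of the pairs over
         which [v] is the join. *)
      apply le_trans with (w ∧ α a); [apply (meet_comm_le hX (fiber_le E) Hw) |].
      apply (join_in_ub hX (P := fun p => fst p ≤ snd p /\ f (fst p) = b0 /\ f (snd p) = b1)
        (F := fun p => w ∧ α (fst p)) (i := (a, a'))); [auto |].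
      apply le_trans with w; [apply Hwb, E | exact Hw]. }
  pose (γ := pos_pb1 f d).
  assert (Eh : forall z : pos_pb f (compM f γ),
    f (fst (proj1_sig z)) = d (snd (proj1_sig (snd (proj1_sig z))))).
  { intros [[a [[a' i] E']] E]; simpl in *; congruence. }
  pose (h := @Build_Mono (pos_pb f (compM f γ)) Z
    (fun z => exist _ (fst (proj1_sig z), snd (proj1_sig (snd (proj1_sig z)))) (Eh z))
    (fun z z' L => conj (proj1 L) (proj2 (proj2 L)))).
  destruct (HD Z γ h (@Build_Mono Z X _ Mθ))
    as [D [d' [δ [q [r [Hd [Hq [Hr [H1 [H2 [H3 [H4 H5]]]]]]]]]]]].
  - split; [reflexivity | split].
    + intros [[a [[a' i] E']] E] Ez; apply sig_eq; simpl in *; congruence.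
    + intros [[a c] E] [[a' c'] E'] [[a'' c''] E''] E1 E2 E3; apply sig_eq; simpl in *; subst.
      reflexivity.
  - intros z; apply (meet_lel hX (HZ z)), Hx.
  - intros [[a [[a' i] E']] E]; simpl in *.
    assert (Hai : α a ≤ β (e i)) by (apply fiber_le; congruence).
    assert (Ha'i : α a' ≤ β (e i)) by (apply fiber_le; exact E').
    assert (Hm : α a' ∧ x i ≤ β (e i))
      by (apply le_trans with (α a'); [apply (meet_lel hX Ha'i), Hx | exact Ha'i]).
    apply (le_meet hX Hai (Hx i)); [apply (meet_lel hX Hai Hm) |].
    apply le_trans with (α a' ∧ x i); [apply (meet_ler hX Hai Hm) |].
    apply (meet_ler hX Ha'i (Hx i)).
  - simpl in Hq.
    (* [q] depends only on the coordinate in [two], so it descends to [k : two -> D]. *)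
    assert (Hqq : forall z z' : Z, pos_pb2 f d z = pos_pb2 f d z' -> q z = q z').
    { intros [[a i] E] [[a' i'] E'] Ei; simpl in *; subst i'.
      assert (Eaz : f a = f a') by congruence.
      assert (G := H2 (exist _ (a, exist _ (a', i) E') Eaz)); simpl in G.
      rewrite <- G; apply f_equal, sig_eq; reflexivity. }
    destruct (lax_maps_pos_maps HM (D := two) (D' := D) (d := d) (d' := d') (h := q))
      as [k [[K1 K2] _]]; [intros z; rewrite H1; apply (proj2_sig z) | exact Hqq |].
    assert (Hk : forall (i : two) a, f a = e i -> α a ∧ δ (k i) ≤ x i /\ α a ∧ x i ≤ δ (k i)).
    { intros i a E.
      pose (z := exist _ (a, i) E : Z).
      assert (Ekz : k i = q z) by exact (K2 z).
      assert (E' : f a = d' (k i)) by (rewrite K1; exact E).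
      split.
      - apply le_trans with (α a ∧ x i); [| apply (meet_ler hX (HZ z)), Hx].
        assert (Gz := Hr (exist _ (a, k i) E')); simpl in Gz.
        rewrite (H5 (exist _ (a, k i) E') z eq_refl Ekz) in Gz; exact Gz.
      - rewrite Ekz; exact (Hq z). }
    assert (Hδ : forall i : two, δ (k i) ≤ β (e i)).
    { intros i; apply le_trans with (β (d' (k i))); [apply Hd |].
      rewrite K1; apply le_refl. }
    (* By [Hk], meets with [α a] do not distinguish [x i] from [δ (k i)], so
       [w ≤ δ (k false) ≤ δ (k true) ≤ v]. *)
    apply le_trans with (δ (k false)).
    { apply (lax_maps_reflect_le HM Hw (Hδ false)); intros a E; apply (Hk false a E). }
    apply le_trans with (δ (k true)); [apply monotone, monotone; discriminate |].
    apply (lax_maps_reflect_le HM (Hδ true) Hv1); intros a E; apply (Hk true a E).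
Qed.

(** The chain condition with [b0 = b1 = d x] writes [δ x] as the join of the [δ x ∧ α a] over the
    fibre, and each term is at most [δ' (h (a, x)) = δ' (k x)]. *)
Lemma pos_maps_lax_maps :
  pos_maps_descend f -> chain_join_condition -> lax_maps_descend α β f.
Proof.
  intros H HJ D D' d d' δ δ' h Hδ Hδ' hh H1 H2.
  destruct (H D D' d d' h H1 H2) as [k [[K1 K2] Uk]].
  exists k; split; [split; [| exact (conj K1 K2)] | intros k' [_ K']; exact (Uk k' K')].
  intros x; rewrite (HJ _ _ _ (le_refl (d x)) (Hδ x)).
  apply (join_in_lub hX); [rewrite <- K1; apply Hδ' |].
  intros [a a'] [_ [E _]]; simpl in *.
  apply le_trans with (α a ∧ δ x); [apply (meet_comm_le hX (Hδ x)), fiber_le, E |].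
  apply le_trans with (δ' (h (exist _ (a, x) E))); [exact (hh (exist _ (a, x) E)) |].
  apply le_of_eq, f_equal; symmetry; exact (K2 (exist _ (a, x) E)).
Qed.

Lemma pos_data_lax_data :
  pos_data_descend f -> chain_join_condition -> gluing_condition -> lax_data_descend α β f.
Proof.
  intros H HJ HG Z γ h θ Hh Hγ hh.
  destruct (H Z γ h Hh) as [D [d [q [r [H1 [H2 [H3 [H4 H5]]]]]]]].
  (* Off the fibre of [d x], where [r] is not available, [σ x] is made
     compatible by taking it to be [α]. *)
  pose (σ := fun (x : D) (a : A) =>
    match excluded_middle_informative (f a = d x) with
    | left E => θ (r (exist _ (a, x) E))
    | right _ => α a
    end).
  assert (σE : forall x a (E : f a = d x), σ x a = θ (r (exist _ (a, x) E))).
  { intros x a E; unfold σ; destruct excluded_middle_informative as [E' | n];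
      [rewrite (proof_irrelevance _ E' E); reflexivity | destruct (n E)]. }
  assert (σα : forall x a, σ x a ≤ α a).
  { intros x a; unfold σ; destruct excluded_middle_informative as [E | n]; [| apply le_refl].
    eapply le_trans; [apply Hγ |]; rewrite H3; apply le_refl. }
  (* [a · (a', x) = (a, x)] *)
  assert (act : forall x a a' (E : f a = d x) (E' : f a' = d x),
    α a ∧ θ (r (exist _ (a', x) E')) ≤ θ (r (exist _ (a, x) E))).
  { intros x a a' E E'.
    assert (Ez : f a = compM f γ (r (exist _ (a', x) E')))
      by (simpl; rewrite H3; simpl; congruence).
    pose (z := exist _ (a, r (exist _ (a', x) E')) Ez : pos_pb f (compM f γ)).
    rewrite (H5 (exist _ (a, x) E) (h z)); [exact (hh z) | |].
    - rewrite (proj1 Hh); reflexivity.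
    - rewrite H2; simpl; rewrite H4; reflexivity. }
  assert (Hσ : forall x, compatible_family (σ x)).
  { intros x; split; [apply σα |].
    (* One inequality is enough, by exchanging [a] and [a']. On the fibre of [d x] it is [act]; off
       it, [σ x a] is [α a]. *)
    assert (C : forall a a', f a = f a' -> σ x a' ∧ α a ≤ α a' ∧ σ x a).
    { intros a a' Eaa.
      assert (Ha := hf a); assert (Ha' := fiber_le (eq_sym Eaa)).
      assert (Sa := le_trans (σα x a) Ha); assert (Sa' := le_trans (σα x a') Ha').
      apply (le_meet hX Ha' Sa);
        [apply le_trans with (σ x a'); [apply (meet_lel hX Sa' Ha) | apply σα] |].
      destruct (classic (f a = d x)) as [E | n].
      - assert (E' : f a' = d x) by congruence.
        apply le_trans with (α a ∧ σ x a'); [apply (meet_comm_le hX Sa' Ha) |].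
        rewrite (σE _ _ E), (σE _ _ E'); apply act.
      - apply le_trans with (α a); [apply (meet_ler hX Sa' Ha) |].
        unfold σ; destruct excluded_middle_informative; [contradiction | apply le_refl]. }
    intros b a a' E E'; split; [apply C; congruence |].
    assert (Ha := fiber_le E); assert (Ha' := fiber_le E').
    assert (Sa := le_trans (σα x a) Ha); assert (Sa' := le_trans (σα x a') Ha').
    apply le_trans with (σ x a ∧ α a'); [apply (meet_comm_le hX Ha' Sa) |].
    apply le_trans with (α a ∧ σ x a'); [apply C; congruence |].
    apply (meet_comm_le hX Ha Sa'). }
  assert (Mδ : forall x y : D, x ≤ y ->
    ⋁[β (d x)]_(a | f a = d x) σ x a ≤ ⋁[β (d y)]_(a | f a = d y) σ y a).
  { intros x y L.
    assert (Ld : d x ≤ d y) by (apply monotone, L).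
    set (t := ⋁[β (d y)]_(a | f a = d y) σ y a).
    assert (Ht : t ≤ β (d y)) by apply join_in_le.
    assert (Hxy : β (d x) ≤ β (d y)) by (apply monotone, Ld).
    (* [join_in_lub] needs a bound inside [down (β (d x))], hence the meet with [β (d x)]. *)
    apply le_trans with (t ∧ β (d x)); [| apply (meet_lel hX Ht Hxy)].
    apply (join_in_lub hX); [apply (meet_ler hX Ht Hxy) |].
    intros a E.
    assert (Sx := le_trans (σα x a) (fiber_le E)).
    apply (le_meet hX Ht Hxy); [| exact Sx].
    apply le_trans with (t ∧ β (d x)); [| apply (meet_lel hX Ht Hxy)].
    (* For [a0 ≤ a1] over [d x ≤ d y], [σ x a ∧ α a0 ≤ σ x a0] by [act], and [σ x a0 ≤ σ y a1]
       because [r] and [θ] are monotone. *)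
    rewrite (HJ _ _ _ Ld Sx).
    apply (join_in_lub hX); [apply (meet_ler hX Ht Hxy) |].
    intros [a0 a1] [La [E0 E1]]; simpl in *.
    assert (H0 := fiber_le E0).
    apply (le_meet hX Ht Hxy);
      [| apply le_trans with (σ x a); [apply (meet_lel hX Sx H0) | exact Sx]].
    apply le_trans with (σ x a0).
    - apply le_trans with (α a0 ∧ σ x a); [apply (meet_comm_le hX Sx H0) |].
      rewrite (σE _ _ E), (σE _ _ E0); apply act.
    - apply le_trans with (σ y a1).
      + rewrite (σE _ _ E0), (σE _ _ E1); apply monotone, monotone; split; assumption.
      + apply (join_in_ub hX (P := fun a => f a = d y)); [exact E1 |].
        exact (le_trans (σα y a1) (fiber_le E1)). }
  exists D, d, (@Build_Mono D X _ Mδ), q, r.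
  split; [intros x; apply join_in_le |].
  split; [| split; [| auto]].
  - intros c; simpl.
    assert (Ec : f (γ c) = d (q c)) by (symmetry; apply H1).
    apply le_trans with (σ (q c) (γ c)).
    { rewrite (σE _ _ Ec), (H5 (exist _ (γ c, q c) Ec) c eq_refl eq_refl); apply le_refl. }
    apply (join_in_ub hX (P := fun a => f a = d (q c))); [exact Ec |].
    exact (le_trans (σα (q c) (γ c)) (fiber_le Ec)).
  - intros [[a x] E]; simpl in *.
    rewrite <- (σE _ _ E); apply (HG _ (Hσ x) _ _ E).
Qed.

Lemma lax_descent_iff :
  (lax_maps_descend α β f /\ lax_data_descend α β f) <->
  (pos_maps_descend f /\ pos_data_descend f) /\ chain_join_condition /\ gluing_condition.
Proof.
  split.
  - intros [HM HD]; split; [split | split].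
    + apply lax_maps_pos_maps, HM.
    + apply lax_data_pos_data, HD.
    + apply lax_descent_chain_join; assumption.
    + apply lax_data_gluing, HD.
  - intros [[HM HD] [HJ HG]]; split.
    + apply pos_maps_lax_maps; assumption.
    + apply pos_data_lax_data; assumption.
Qed.

End LaxDescent.

Theorem theoremA2 (X : Poset) (hX : locally_complete X)
    (A B : Poset) (α : Mono A X) (β : Mono B X)
    (f : Mono A B) (hf : forall a : A, α a ≤ β (f a)) :
  let F : @Hom (PosLax X) (Build_LaxOb α) (Build_LaxOb β) :=
    Build_LaxHom (Build_LaxOb α) (Build_LaxOb β) f hf in
  (local_joins_are_joins X ->
     (regular_epi (PosLax X) F <->
      regular_epi Pos f /\
      forall b : B, β b = ⋁[β b]_(a | f a ≤ b) α a)) /\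
  (local_joins_are_joins X ->
     (stable_regular_epi (PosLax X) F <->
      stable_regular_epi Pos f /\
      forall (b : B) (w : X), w ≤ β b ->
        w = ⋁[β b]_(a | f a = b) (w ∧ α a))) /\
  (effective_descent (PosLax_pullbacks hX) F <->
     effective_descent Pos_pullbacks f /\
     (forall (b0 b1 : B) (w : X), b0 ≤ b1 -> w ≤ β b0 ->
        w = ⋁[β b0]_(p | fst p ≤ snd p /\ f (fst p) = b0 /\ f (snd p) = b1)
              (w ∧ α (fst p))) /\
     (forall σ : A -> X,
        (forall a : A, σ a ≤ α a) ->
        (forall (b : B) (a a' : A), f a = b -> f a' = b ->
           σ a' ∧ α a ≅ α a' ∧ σ a) ->
        forall (b : B) (a' : A), f a' = b ->
          α a' ∧ (⋁[β b]_(a | f a = b) σ a) ≅ σ a')).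
Proof.
  intros F; split; [| split].
  - intros hJ; exact (lax_regular_epi_iff hX hJ F).
  - intros hJ; exact (lax_stable_regular_epi_iff hX hJ hf).
  (* Both sides are reduced to descent conditions on elements, which [lax_descent_iff] compares. *)
  - etransitivity; [apply (lax_effective_descent_iff hX hf) |].
    rewrite pos_effective_descent_iff, (lax_descent_iff hX hf).
    unfold chain_join_condition, gluing_condition, compatible_family.
    split; intros [HP [HJ HG]]; (split; [exact HP | split; [exact HJ |]]).
    + intros σ Hσ Hc; exact (HG σ (conj Hσ Hc)).
    + intros σ [Hσ Hc]; exact (HG σ Hσ Hc).
Qed.
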